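(* Let $\lambda>0$. The function $\mathcal{N}_\lambda$ on $\mathbb{R}^3$ is a norm if and only if $\lambda\le\frac1{23}$. For $0<\lambda\le\frac{1}{23}$, the corresponding Banach space $X_\lambda=(\mathbb{R}^3,\mathcal{N}_\lambda)$ is isometric to a subspace of $L_{1/4}$ if and only if $\lambda\le\frac1{26}$, and $X_\lambda$ is not isometric to a subspace of $L_{1/2}$ if $\lambda>\frac1{28}$. Thus, for $\frac1{28}<\lambda\le\frac1{26}$, the space $X_\lambda$ is a Banach space which is isometric to a subspace of $L_{1/4}$ but is not isometric to a subspace of $L_{1/2}$.
   Context: All spaces are real. For $\lambda>0$ the function $\mathcal{N}_\lambda$ on $\mathbb{R}^3$ is defined by $\mathcal{N}_\lambda(0)=0$ and, for $x\ne0$, $$\mathcal{N}_\lambda(x)=(x_1^2+x_2^2+x_3^2)^{1/2}\Big(1+\lambda\,\frac{x_1^2+x_2^2-2x_3^2}{x_1^2+x_2^2+x_3^2}\Big)^4 .$$ For $q>0$, $L_q=L_q([0,1])$ with Lebesgue measure and $\|f\|_q=\big(\int_0^1|f(t)|^q\,dt\big)^{1/q}$ (a quasi-norm when $q<1$). A normed space $(X,\|\cdot\|)$ is isometric to a subspace of $L_q$ if there is a linear map $T:X\to L_q$ with $\|Tx\|_q=\|x\|$ for all $x\in X$. *)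

(* Defs.v *)
From HB Require Import structures.
From mathcomp Require Import all_boot all_order all_algebra.
From mathcomp Require Import all_classical all_reals all_analysis.

Set Implicit Arguments.
Unset Strict Implicit.
Unset Printing Implicit Defensive.

Import Order.TTheory GRing.Theory Num.Theory.
Import numFieldNormedType.Exports.

Local Open Scope classical_set_scope.
Local Open Scope ring_scope.

Record is_norm (R : realType) (V : lmodType R) (N : V -> R) : Prop := IsNorm {
  is_norm_ge0 : forall x, 0 <= N x;
  is_norm_eq0 : forall x, N x = 0 -> x = 0;
  is_normZ : forall (a : R) x, N (a *: x) = `|a| * N x;
  is_normD : forall x y, N (x + y) <= N x + N y
}.

(* The normed space (V, N): an alias of V whose library norm is N and whose
   topology is induced by N, whatever structure V itself already carries. *)
Definition normed_by (R : realType) (V : lmodType R) (N : V -> R)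
  of is_norm N : Type := V.

Section normed_by.
Context (R : realType) (V : lmodType R) (N : V -> R) (hN : is_norm N).

HB.instance Definition _ := GRing.Lmodule.copy (normed_by hN) V.

HB.instance Definition _ := @Lmodule_isNormed.Build R (normed_by hN) N
  (is_normD hN) (is_normZ hN) (is_norm_eq0 hN).

End normed_by.

Definition is_banach (R : realType) (X : normedModType R) : Prop :=
  forall F : set_system X, ProperFilter F -> cauchy F -> cvg F.

(* Lebesgue measure on [0, 1], as a measure on R that ignores the complement
   of [0, 1]. *)
Definition lebesgue01 (R : realType) :
    {measure set (measurableTypeR R) -> \bar R} :=
  mrestr (@lebesgue_measure R) (measurable_itv `[0 : R, 1]).

(* The library has the vector space L_q only for 1 <= q, while its measurable
   functions of finite q-norm, Lfun, and Lnorm make sense for all q > 0.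
   A linear map into L_q is given by a choice of representatives T x : R -> R
   of its values, so it is linear up to equality almost everywhere. *)
Definition isometric_to_subspace_Lq (R : realType) (q : R)
    (X : normedModType R) : Prop :=
  exists T : X -> measurableTypeR R -> R,
    [/\ forall x, T x \in Lfun (lebesgue01 R) q%:E,
        forall (a : R) x y,
          T (a *: x + y) = (fun t => a * T x t + T y t) %[ae lebesgue01 R] &
        forall x, 'N[lebesgue01 R]_q%:E[EFin \o T x]%E = `|x|%:E].

Definition normN (R : realType) (lambda : R) (x : 'rV[R]_3) : R :=
  let x1 := x 0 0 in let x2 := x 0 1 in let x3 := x 0 2 in
  if x == 0 then 0 else
  Num.sqrt (x1 ^+ 2 + x2 ^+ 2 + x3 ^+ 2) *
  (1 + lambda * ((x1 ^+ 2 + x2 ^+ 2 - 2 * x3 ^+ 2) /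
                 (x1 ^+ 2 + x2 ^+ 2 + x3 ^+ 2))) ^+ 4.

(* Main.v *)
Require Import Defs.
From HB Require Import structures.
From mathcomp Require Import all_boot all_order all_algebra.
From mathcomp Require Import all_classical all_reals all_analysis.
From mathcomp Require Import measurable_realfun ring lra.
Import Order.TTheory GRing.Theory Num.Theory.
Import numFieldNormedType.Exports.
Local Open Scope classical_set_scope.
Local Open Scope ring_scope.

(** Put u = x3 / |x| and p(u) = 1 + l - 3 l u^2, so that
    the function N_l is N(x) = |x| p(u)^4.

    Norm.  When l <= 1/23, the tangent functional of N at each nonzero point
    lies below N ([support_le]).  At unit vectors x, y with third coordinates
    u, v and c = <x, y>, the inequality p(v)^4 + 3 p(u)^4 >= 4 p(v) p(u)^3
    reduces this to
      (1 - c) (1 + l + 21 l u^2) >= 12 l (v - u)^2,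
    which holds because (v - u)^2 <= |x - y|^2 = 2 (1 - c).  A function that
    is 1-homogeneous and has a supporting functional everywhere is subadditive.
    When l > 1/23, N(1, 0, s) < N(1, 0, 0) for a suitable s, and the triangle
    inequality fails for (1, 0, s) + (1, 0, -s) = 2 (1, 0, 0).

    Fractional powers as averages.  For a standard Gaussian vector Y of space,
    rotation invariance and the moment recursion E|z|^(s+2) = (s+1) E|z|^s give
    E |<x, Y>|^q D(Y) in closed form for D(y) = A |y|^4 + B |y|^2 y3^2 + C y3^4
    ([mean_is_dens4]); it is |x|^q times an even quartic polynomial of u.
    Solving for A, B, C represents N^(1/4) and N^(1/2) in this way, with the
    value A + B + C of D at the pole a positive multiple of 1 - 26 l for
    q = 1/4 and of 1 - 28 l - 44 l^2 for q = 1/2.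

    Embedding for l <= 1/26.  For q = 1/4 the density D is then nonnegative
    everywhere, so x |-> D(Y)^4 <x, Y>, with D normalised, is isometric for
    the 1/4-quasi-norm.  It remains to realise Y as a measurable function on
    [0, 1] ([ge0_integral_parametrize]).

    Obstruction.  Suppose that x |-> <x, f> embeds the space into L_q.  Then
    E_t |<x, f(t)>|^q = E |<x, Y>|^q D(Y) for all x.  Integrating both sides
    against the Hermite polynomial He_2k(x3) under the Gaussian measure in x
    turns |<x, y>|^q into a multiple of |y|^q (y3/|y|)^(2k), with a factor that
    depends on k and q only and does not vanish ([mean_is_hermite_dot3],
    [wmoment_hermite_even]).  Hence
    E |Y|^q (Y3/|Y|)^(2k) D(Y) = E_t |f|^q (f3/|f|)^(2k) >= 0 for every k
    ([zonal_duality]).  As k grows the left side only sees the poles, so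
    A + B + C >= 0 ([pole_ge0]).  This forces l <= 1/26 when q = 1/4, and
    contradicts l > 1/28 when q = 1/2.

    Throughout, a point of space is a triple (y3, (y1, y2)): the polar
    coordinate comes first. *)

(** * Rotation invariance of the Gaussian measure *)

Lemma lebesgue_shift_pushforward (R : realType) (a : R) (A : set (measurableTypeR R)) :
  measurable A ->
  pushforward lebesgue_measure (fun x : measurableTypeR R => x + a : measurableTypeR R) A =
  lebesgue_measure A.
Proof.
move=> mA; apply/esym/lebesgue_measure_unique => //=.
  by apply: measurable_funD.
move=> ms _ [[b c]] _ <-.
rewrite /pushforward.
rewrite (_ : _ @^-1` _ = `]b - a, c - a]%classic); last first.
  by apply/seteqP; split => x /=; rewrite !in_itv/= ltrBlDr lerBrDr.
rewrite !lebesgue_measure_itv/= !lte_fin ltrD2r -!EFinB.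
by case: ifP => //; rewrite opprB addrA subrK.
Qed.

Lemma ge0_integral_shift (R : realType) (a : R) (f : measurableTypeR R -> \bar R) :
  measurable_fun setT f -> (forall x, 0 <= f x)%E ->
  (\int[lebesgue_measure]_x f (x + a)%R = \int[lebesgue_measure]_x f x)%E.
Proof.
move=> mf f0.
have ms : measurable_fun setT (fun x : measurableTypeR R => x + a : measurableTypeR R).
  by apply: measurable_funD.
have := @ge0_integral_pushforward _ _ _ _ R _ ms lebesgue_measure setT f measurableT mf.
rewrite preimage_setT => <-; last by move=> x _; exact: f0.
by apply: eq_measure_integral => A mA _; exact: lebesgue_shift_pushforward.
Qed.

Lemma ge0_integral_normal_prob (R : realType) (f : measurableTypeR R -> \bar R) :
  measurable_fun setT f -> (forall x, 0 <= f x)%E ->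
  (\int[normal_prob 0 1]_x f x = \int[lebesgue_measure]_x (f x * (normal_pdf 0 1 x)%:E))%E.
Proof.
move=> mf f0.
pose nu : {finite_measure set (measurableTypeR R) -> \bar R} := normal_prob (0 : R) 1.
have dom : nu `<< (@lebesgue_measure R) by exact: normal_prob_dominates.
rewrite -(@Radon_Nikodym_SigmaFinite.change_of_variables _ _ _ nu lebesgue_measure dom f setT f0 measurableT mf).
apply: ae_eq_integral => //.
- apply: emeasurable_funM => //; apply: (measurable_int lebesgue_measure).
  exact: Radon_Nikodym_SigmaFinite.f_integrable.
- apply: emeasurable_funM => //; apply/measurableT_comp => //=.
  exact: measurable_normal_pdf.
- apply: ae_eqe_mul2l.
  apply: integral_ae_eq => //.
  + exact: Radon_Nikodym_SigmaFinite.f_integrable.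
  + by apply/measurableT_comp => //; exact: measurable_normal_pdf.
  + by move=> E _ mE; rewrite -Radon_Nikodym_SigmaFinite.f_integral.
Qed.

Section plane_lebesgue.
Context (R : realType).
Local Notation T := (measurableTypeR R).
Local Notation lam := (@lebesgue_measure R).

Lemma ge0_integral_shear2 (b : R) (H : T * T -> \bar R) :
  measurable_fun setT H -> (forall z, 0 <= H z)%E ->
  (\int[lam]_x \int[lam]_y H (x, y + b * x)%R = \int[lam]_x \int[lam]_y H (x, y))%E.
Proof.
move=> mH H0; apply: eq_integral => x _.
apply: (@ge0_integral_shift R (b * x) (fun y => H (x, y))) => //.
exact: measurableT_comp mH (measurable_pair1 x).
Qed.

Lemma ge0_integral_shear1 (a : R) (H : T * T -> \bar R) :
  measurable_fun setT H -> (forall z, 0 <= H z)%E ->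
  (\int[lam]_x \int[lam]_y H (x + a * y, y)%R = \int[lam]_x \int[lam]_y H (x, y))%E.
Proof.
move=> mH H0.
have mHs : measurable_fun setT (fun z : T * T => H (z.1 + a * z.2, z.2)%R).
  apply: (measurableT_comp mH) => /=; apply/measurable_fun_pair => //=.
  by apply: measurable_funD => //; apply: measurable_funM.
apply: etrans; first exact: (fubini_tonelli (fun z : T * T => H (z.1 + a * z.2, z.2)%R)).
apply: etrans; last by apply/esym; exact: (fubini_tonelli H).
apply: eq_integral => y _.
apply: (@ge0_integral_shift R (a * y) (fun x => H (x, y))) => //.
exact: measurableT_comp mH (measurable_pair2 y).
Qed.

(** A plane rotation is a product of three shears, horizontal, vertical and
    horizontal again, and a shear translates each line of one direction; so
    Tonelli and translation invariance suffice. *)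
Lemma ge0_integral_rot_lebesgue (c s : R) (H : T * T -> \bar R) :
  c ^+ 2 + s ^+ 2 = 1 -> s != 0 ->
  measurable_fun setT H -> (forall z, 0 <= H z)%E ->
  (\int[lam]_x \int[lam]_y H (c * x - s * y, s * x + c * y)%R = \int[lam]_x \int[lam]_y H (x, y))%E.
Proof.
(* The horizontal shears have amplitude a = - tan (t / 2), for a rotation of angle t. *)
move=> cs s0 mH H0; pose a := (c - 1) / s.
have as1 : a * s = c - 1 by rewrite /a divfK.
have ac : a * (1 + c) = - s by apply: (mulIf s0); rewrite mulrAC as1; rewrite mulNr -expr2; nra.
have m1 : measurable_fun setT (fun z : T * T => (z.1 + a * z.2, z.2) : T * T).
  by apply/measurable_fun_pair => //=; apply: measurable_funD => //; apply: measurable_funM.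
have m2 : measurable_fun setT (fun z : T * T => (z.1, z.2 + s * z.1) : T * T).
  by apply/measurable_fun_pair => //=; apply: measurable_funD => //; apply: measurable_funM.
have mH1 := measurableT_comp mH m1; have mH2 := measurableT_comp mH1 m2.
apply: etrans; last exact: (@ge0_integral_shear1 a H).
apply: etrans; last exact: (@ge0_integral_shear2 s (fun z => H (z.1 + a * z.2, z.2)%R)).
apply: etrans; last exact: (@ge0_integral_shear1 a
  (fun z => H (z.1 + a * (z.2 + s * z.1), z.2 + s * z.1)%R)).
apply: eq_integral => x _; apply: eq_integral => y _; congr H; congr pair => /=.
  transitivity ((1 + a * s) * x + a * (1 + (1 + a * s)) * y); last by ring.
  rewrite as1; have -> : 1 + (c - 1) = c by ring.
  by rewrite ac; ring.
transitivity (s * x + (1 + a * s) * y); last by ring.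
by rewrite as1; ring.
Qed.
End plane_lebesgue.

Section gauss2.
Context (R : realType).
Local Notation T := (measurableTypeR R).
Local Notation lam := (@lebesgue_measure R).
Local Notation g := (normal_prob (0:R) 1).

Lemma normal_pdf_mul (x y : R) :
  normal_pdf 0 1 x * normal_pdf 0 1 y = normal_peak 1 ^+ 2 * expR (- (x ^+ 2 + y ^+ 2) / 2).
Proof.
rewrite !normal_pdfE ?oner_eq0// mulrACA -expr2 /normal_fun -expRD; congr (_ * expR _).
by rewrite !subr0 expr1n; field.
Qed.

Lemma ge0_integral_gauss2 (F : T * T -> \bar R) :
  measurable_fun setT F -> (forall z, 0 <= F z)%E ->
  (\int[g \x g]_z F z =
   \int[lam]_x \int[lam]_y (F (x, y) * (normal_peak 1 ^+ 2 * expR (- (x ^+ 2 + y ^+ 2) / 2))%:E))%E.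
Proof.
move=> mF F0; rewrite fubini_tonelli1//.
rewrite ge0_integral_normal_prob//=; last 2 first.
- exact: measurable_fun_fubini_tonelli_F.
- by move=> x; apply: integral_ge0.
apply: eq_integral => x _.
have mFx : measurable_fun setT (fun y => F (x, y)) by exact: measurableT_comp mF (measurable_pair1 x).
rewrite /fubini_F ge0_integral_normal_prob//=.
rewrite -ge0_integralZr//=; last 3 first.
- apply: emeasurable_funM => //; apply/measurableT_comp => //=; exact: measurable_normal_pdf.
- by move=> y _; rewrite mule_ge0// lee_fin normal_pdf_ge0.
- by rewrite lee_fin normal_pdf_ge0.
by apply: eq_integral => y _; rewrite -muleA -EFinM mulrC normal_pdf_mul.
Qed.

Lemma measurable_rot (c s : R) :
  measurable_fun setT (fun z : T * T => (c * z.1 - s * z.2, s * z.1 + c * z.2) : T * T).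
Proof.
by apply/measurable_fun_pair => /=; [apply: measurable_funB|apply: measurable_funD]; apply: measurable_funM.
Qed.

Lemma ge0_integral_rot_gauss2 (c s : R) (F : T * T -> \bar R) :
  c ^+ 2 + s ^+ 2 = 1 -> measurable_fun setT F -> (forall z, 0 <= F z)%E ->
  (\int[g \x g]_z F (c * z.1 - s * z.2, s * z.1 + c * z.2)%R = \int[g \x g]_z F z)%E.
Proof.
wlog s0 : c s F / s != 0 => [hw|] cs mF F0.
  have [s0|] := eqVneq s 0; last by move=> ?; exact: hw.
  (* With s = 0 the rotation is the identity or a half turn, that is, two quarter turns. *)
  have : (c == 1) || (c == -1) by rewrite -eqf_sqr expr1n -cs s0 expr0n/= addr0.
  case/orP => /eqP c1.
    by apply: eq_integral => -[x y] _; rewrite c1 s0/= !mul1r !mul0r subr0 add0r.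
  have one0 : (1 : R) != 0 by exact: oner_neq0.
  have c0 : (0 : R) ^+ 2 + 1 ^+ 2 = 1 by rewrite expr0n/= expr1n add0r.
  rewrite -(hw 0 1 F)//.
  rewrite -(hw 0 1 (fun z => F (0 * z.1 - 1 * z.2, 1 * z.1 + 0 * z.2)))//; last first.
    exact: measurableT_comp mF (measurable_rot 0 1).
  by apply: eq_integral => -[x y] _ /=; rewrite c1 s0; congr (F (_, _)); ring.
have mr := measurable_rot c s.
have mFr := measurableT_comp mF mr.
pose w (z : T * T) := (normal_peak 1 ^+ 2 * expR (- (z.1 ^+ 2 + z.2 ^+ 2) / 2))%:E.
pose H z := (F z * w z)%E.
have mw : measurable_fun setT w.
  apply/measurable_EFinP; apply: measurable_funM => //.
  apply: measurableT_comp => //; apply: measurable_funM => //; apply: measurable_funN.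
  by apply: measurable_funD; apply: measurable_funX.
have w0 z : (0 <= w z)%E by rewrite lee_fin mulr_ge0 ?expR_ge0// sqr_ge0.
have mH : measurable_fun setT H by exact: emeasurable_funM.
have H0 z : (0 <= H z)%E by exact: mule_ge0.
apply: etrans; first exact: ge0_integral_gauss2.
apply: etrans; last by apply/esym; exact: ge0_integral_gauss2.
apply: etrans; last exact: (@ge0_integral_rot_lebesgue _ c s H).
apply: eq_integral => x _; apply: eq_integral => y _.
congr (_ * (_ * expR (- _ / 2))%:E)%E => /=.
transitivity ((c ^+ 2 + s ^+ 2) * (x ^+ 2 + y ^+ 2)); last by ring.
by rewrite cs mul1r.
Qed.
End gauss2.

Section gauss3.
Context (R : realType).
Local Notation T := (measurableTypeR R).
Local Notation T3 := (T * (T * T))%type.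
Definition gauss1 : probability T R := normal_prob (0:R) 1.
Definition gauss2 : probability (T * T)%type R := (gauss1 \x gauss1)%E.
Definition gauss3 : probability T3 R := (gauss1 \x gauss2)%E.

Lemma ge0_integral_gauss3_fst (F : T3 -> \bar R) :
  measurable_fun setT F -> (forall z, 0 <= F z)%E ->
  (\int[gauss3]_z F z = \int[gauss1]_p \int[gauss2]_w F (p, w))%E.
Proof. move=> mF F0; exact: (@fubini_tonelli1 _ _ T (T * T)%type R gauss1 gauss2 F mF F0). Qed.

Lemma ge0_integral_gauss2_fst (F : T * T -> \bar R) :
  measurable_fun setT F -> (forall z, 0 <= F z)%E ->
  (\int[gauss2]_z F z = \int[gauss1]_p \int[gauss1]_q F (p, q))%E.
Proof. move=> mF F0; exact: (@fubini_tonelli1 _ _ T T R gauss1 gauss1 F mF F0). Qed.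

Lemma measurable_gauss3_marginal (F : T3 -> \bar R) :
  measurable_fun setT F -> (forall z, 0 <= F z)%E ->
  measurable_fun setT (fun w : T * T => \int[gauss1]_r F (w.1, (w.2, r)))%E.
Proof.
move=> mF F0; pose F' (v : (T * T) * T) := F (v.1.1, (v.1.2, v.2)).
have mF' : measurable_fun setT F'.
  apply: (measurableT_comp mF); apply/measurable_fun_pair => /=.
    by apply: measurableT_comp => //; exact: measurable_fst.
  apply/measurable_fun_pair => //=.
  by apply: measurableT_comp => //; exact: measurable_snd.
by apply: (measurable_fun_fubini_tonelli_F (m2 := gauss1) F') => // v; exact: F0.
Qed.

Lemma ge0_integral_gauss3 (F : T3 -> \bar R) :
  measurable_fun setT F -> (forall z, 0 <= F z)%E ->
  (\int[gauss3]_z F z = \int[gauss2]_w \int[gauss1]_r F (w.1, (w.2, r)))%E.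
Proof.
move=> mF F0.
apply: etrans; first exact: ge0_integral_gauss3_fst.
apply: etrans; last first.
  apply/esym; apply: ge0_integral_gauss2_fst; last by move=> w; apply: integral_ge0.
  exact: measurable_gauss3_marginal.
apply: eq_integral => p _; apply: (@ge0_integral_gauss2_fst (fun w => F (p, w))) => //.
exact: measurableT_comp mF (measurable_pair1 p).
Qed.

(** Stated on integrals of nonnegative functions rather than on measures of
    sets: it composes, and is used, in this form. *)
Definition gauss3_preserving (f : T3 -> T3) :=
  measurable_fun setT f /\ forall F : T3 -> \bar R,
    measurable_fun setT F -> (forall z, 0 <= F z)%E ->
    (\int[gauss3]_z F (f z) = \int[gauss3]_z F z)%E.

Lemma gauss3_preserving_comp f h :
  gauss3_preserving f -> gauss3_preserving h -> gauss3_preserving (f \o h).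
Proof.
move=> [mf pf] [mh ph]; split; first exact: measurableT_comp.
move=> F mF F0; rewrite -(pf F)//.
by apply: (ph (F \o f)) => [|z]; [exact: measurableT_comp mF mf|exact: F0].
Qed.

Definition rot23 (c s : R) (z : T3) : T3 :=
  (z.1, (c * z.2.1 - s * z.2.2, s * z.2.1 + c * z.2.2)).
Definition rot12 (c s : R) (z : T3) : T3 :=
  (c * z.1 - s * z.2.1, (s * z.1 + c * z.2.1, z.2.2)).

Lemma gauss3_preserving_rot23 c s : c ^+ 2 + s ^+ 2 = 1 -> gauss3_preserving (rot23 c s).
Proof.
move=> cs; have mr : measurable_fun setT (rot23 c s).
  apply/measurable_fun_pair => /=; first exact: measurable_fst.
  exact: (measurableT_comp (measurable_rot R c s) measurable_snd).
split => // F mF F0.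
apply: etrans; first by apply: ge0_integral_gauss3_fst => //; exact: measurableT_comp mF mr.
apply: etrans; last by apply/esym; exact: ge0_integral_gauss3_fst.
apply: eq_integral => p _.
apply: (@ge0_integral_rot_gauss2 R c s (fun w => F (p, w))) => //.
exact: measurableT_comp mF (measurable_pair1 p).
Qed.

Lemma gauss3_preserving_rot12 c s : c ^+ 2 + s ^+ 2 = 1 -> gauss3_preserving (rot12 c s).
Proof.
move=> cs; have mr : measurable_fun setT (rot12 c s).
  have mh : measurable_fun setT (fun z : T3 => (z.1, z.2.1) : T * T).
    apply/measurable_fun_pair => //=; apply: measurableT_comp => //; exact: measurable_snd.
  have := measurableT_comp (measurable_rot R c s) mh => /= m.
  apply/measurable_fun_pair => /=; first exact: (measurableT_comp measurable_fst m).
  apply/measurable_fun_pair => /=; first exact: (measurableT_comp measurable_snd m).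
  by apply: measurableT_comp => //; exact: measurable_snd.
split => // F mF F0.
apply: etrans; first by apply: ge0_integral_gauss3 => //; exact: measurableT_comp mF mr.
apply: etrans; last by apply/esym; exact: ge0_integral_gauss3.
apply: (@ge0_integral_rot_gauss2 R c s (fun w => \int[gauss1]_r F (w.1, (w.2, r)))%E) => //.
  exact: measurable_gauss3_marginal.
by move=> z; apply: integral_ge0.
Qed.

(** A rotation of the first and second entries by the latitude of x, followed
    by one about the polar axis by its longitude, carries the polar axis to the
    direction of x.  The last two clauses determine the zonal functions of
    the image. *)
Lemma gauss3_rotation (x1 x2 x3 : R) (l := Num.sqrt (x1 ^+ 2 + x2 ^+ 2 + x3 ^+ 2)) :
  l != 0 -> exists2 f : T3 -> T3, gauss3_preserving f & forall z,
   [/\ x3 * (f z).1 + x1 * (f z).2.1 + x2 * (f z).2.2 = l * z.1,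
       (f z).1 = x3 / l * z.1 - Num.sqrt (1 - (x3 / l) ^+ 2) * z.2.1 &
       (f z).1 ^+ 2 + (f z).2.1 ^+ 2 + (f z).2.2 ^+ 2 = z.1 ^+ 2 + z.2.1 ^+ 2 + z.2.2 ^+ 2].
Proof.
move=> l0; pose h := Num.sqrt (x1 ^+ 2 + x2 ^+ 2).
have hE : h ^+ 2 = x1 ^+ 2 + x2 ^+ 2 by rewrite sqr_sqrtr// addr_ge0// sqr_ge0.
have lE : l ^+ 2 = x1 ^+ 2 + x2 ^+ 2 + x3 ^+ 2 by rewrite sqr_sqrtr// !addr_ge0// sqr_ge0.
have [c [s [cs x1E x2E]]] : exists c s, [/\ c ^+ 2 + s ^+ 2 = 1, x1 = h * c & x2 = h * s].
  have [h0|h0] := eqVneq h 0.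
    have /eqP : x1 ^+ 2 + x2 ^+ 2 = 0 by rewrite -hE h0 expr0n.
    rewrite paddr_eq0 ?sqr_ge0// !sqrf_eq0 => /andP[/eqP-> /eqP->].
    by exists 1, 0; rewrite expr1n expr0n/= addr0 h0 !mul0r.
  exists (x1 / h), (x2 / h); split; rewrite ?(mulrC h) ?divfK//.
  by rewrite !expr_div_n -mulrDl -hE divff// sqrf_eq0.
pose u := x3 / l; pose b := Num.sqrt (1 - u ^+ 2).
have l2 : l ^+ 2 != 0 by rewrite sqrf_eq0.
have uE : 1 - u ^+ 2 = (h / l) ^+ 2.
  apply: (mulIf l2); rewrite mulrBl -!exprMn /u !divfK// mul1r lE hE; ring.
have bE : b = h / l by rewrite /b uE sqrtr_sqr ger0_norm// divr_ge0// sqrtr_ge0.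
have bh : b * l = h by rewrite bE divfK.
have ub : u ^+ 2 + b ^+ 2 = 1 by rewrite bE -uE; ring.
exists (rot23 c s \o rot12 u b).
  by apply: gauss3_preserving_comp; [exact: gauss3_preserving_rot23|exact: gauss3_preserving_rot12].
move=> [p [q r]]; rewrite /rot23 /rot12/=; split => //.
- have x3E : x3 = u * l by rewrite /u divfK.
  rewrite x1E x2E -bh x3E.
  transitivity (l * ((u ^+ 2 + b ^+ 2) * p + b * (c ^+ 2 + s ^+ 2 - 1) * (b * p + u * q))).
    by ring.
  by rewrite ub cs subrr; ring.
- transitivity ((u ^+ 2 + b ^+ 2) * (p ^+ 2 + q ^+ 2) + r ^+ 2 + (c ^+ 2 + s ^+ 2 - 1) * ((b * p + u * q) ^+ 2 + r ^+ 2)); first by ring.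
  by rewrite ub cs subrr; ring.
Qed.
End gauss3.

(** * Absolute moments of the one-dimensional Gaussian *)
Section moments1.
Set Implicit Arguments.
Unset Strict Implicit.
Context (R : realType).
Local Notation T := (measurableTypeR R).
Local Notation lam := (@lebesgue_measure R).
Local Notation phi := (normal_pdf (0:R) 1).

Lemma integral_powR_itv0 (s u : R) : 0 <= s -> 0 < u ->
  (\int[lam]_(x in `[0%R, u]) (x `^ s)%:E = (u `^ (s + 1) / (s + 1))%:E)%E.
Proof.
move=> s0 u0; have s10 : s + 1 != 0 by rewrite gt_eqF// ltr_wpDl.
pose F (x : R) := (s + 1)^-1 * x `^ (s + 1).
have F'E (x : R) : 0 < x -> is_derive x 1 F (x `^ s).
  move=> x0; have -> : x `^ s = (s + 1)^-1 *: ((s + 1) * x `^ (s + 1 - 1)).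
    by rewrite addrK; apply/esym/mulKf.
  exact: (@is_deriveZ _ _ _ (fun y => y `^ (s + 1)) (s + 1)^-1 x 1 _ (is_derive1_powR (s + 1) x0)).
have cpow (t x : R) : 0 < x -> {for x, continuous (fun x => x `^ t)}.
  move=> x0; apply/differentiable_continuous/derivable1_diffP/derivable_powR.
  by rewrite in_itv/= x0.
have cpow0 (t : R) : 0 <= t -> x `^ t @[x --> 0^'+] --> (0 : R) `^ t.
  rewrite le_eqVlt => /predU1P[<-|t0].
    under eq_fun do rewrite powRr0; rewrite powRr0; exact: cvg_cst.
  by rewrite powR0 ?gt_eqF//; exact: powR_cvg0.
rewrite (@continuous_FTC2 _ (fun x => x `^ s) F)//.
- by rewrite /F powR0// mulr0 sube0 mulrC.
- apply/(continuous_within_itvP _ u0); split.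
  + by move=> x; rewrite in_itv/= => /andP[x0 _]; exact: cpow.
  + exact: cpow0.
  + by apply: cvg_at_left_filter; exact: cpow.
- split.
  + by move=> x; rewrite in_itv/= => /andP[x0 _]; have [] := F'E _ x0.
  + by apply: cvgMl_tmp; apply: cpow0; rewrite addr_ge0.
  + by apply: cvgMl_tmp; apply: cvg_at_left_filter; exact: cpow.
- move=> x; rewrite in_itv/= => /andP[x0 _].
  by rewrite derive1E; have [_ ->] := F'E _ x0.
Qed.

Lemma normal_pdf01 (x : R) : phi x = normal_peak 1 * expR (- (x ^+ 2) / 2).
Proof. by rewrite normal_pdfE ?oner_eq0// /normal_fun subr0 expr1n. Qed.

Lemma is_derive_normal_pdf01 (x : R) : is_derive x 1 phi (- (x * phi x)).
Proof.
have -> : phi = (fun x => normal_peak 1 * expR (- (x ^+ 2) / 2)) by apply/funext => y; exact: normal_pdf01.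
apply: is_derive_eq.
by rewrite /GRing.scale/=; field.
Qed.

Lemma cvg_normal_pdf01y : phi x @[x --> +oo] --> 0.
Proof.
have -> : phi = (fun x => normal_peak 1 * expR (- (x ^+ 2) / 2)) by apply/funext => y; exact: normal_pdf01.
rewrite -[X in _ --> X](mulr0 (normal_peak 1)).
apply: (@cvgMl_tmp _ _ _ _ _ (normal_peak 1)).
under eq_fun do rewrite mulNr.
apply: (cvg_comp (fun x : R => x ^+ 2 / 2) (fun x => expR (- x))); last exact: cvgr_expR.
by apply: gt0_cvgMly; [rewrite invr_gt0|exact: cvgr_expr2].
Qed.

Lemma integral_normal_pdf_tail (x : R) : 0 <= x ->
  (\int[lam]_(u in `[x, +oo[) (u * phi u)%:E = (phi x)%:E)%E.
Proof.
move=> x0.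
have cphi y : {for y, continuous phi} by exact: continuous_normal_pdf.
rewrite (@ge0_continuous_FTC2y _ _ (fun x => - phi x) _ 0)//.
- by rewrite EFinN oppeK add0e.
- by move=> y xy; rewrite mulr_ge0 ?normal_pdf_ge0// (le_trans x0).
- apply: continuous_subspaceT => y; apply: cvgM; first exact: cvg_id. exact: cphi.
- by rewrite -[X in _ --> X]oppr0; apply: cvgN; exact: cvg_normal_pdf01y.
- move=> y xy; apply: derivableN; have [] := is_derive_normal_pdf01 y; done.
- by apply: cvgN; apply: cvg_at_right_filter; exact: cphi.
- move=> y _; rewrite derive1E deriveN; last by have [] := is_derive_normal_pdf01 y.
  by have [_ ->] := is_derive_normal_pdf01 y; rewrite opprK.
Qed.

(** Both sides are the integral of x^s u phi(u) over 0 <= x <= u, up to the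
    factor s + 1: integrating in u first gives phi(x), since u phi(u) is the
    derivative of - phi; integrating in x first gives u^(s+1) / (s+1).  This
    replaces an integration by parts, with its boundary terms. *)
Lemma half_moment_rec (s : R) : 0 <= s ->
  (\int[lam]_(x in `[0%R, +oo[) (x `^ (s + 2) * phi x)%:E =
   (s + 1)%:E * \int[lam]_(x in `[0%R, +oo[) (x `^ s * phi x)%:E)%E.
Proof.
move=> s0; have s10 : 0 < s + 1 by rewrite ltr_wpDl.
have E6 (a : \bar R) : a = ((s + 1)%:E * ((s + 1)^-1%:E * a))%E.
  by rewrite muleA -EFinM divff ?mul1e// gt_eqF.
pose F (z : T * T) : \bar R :=
  (if (0 <= z.1) && (z.1 <= z.2) then z.1 `^ s * (z.2 * phi z.2) else 0)%:E.
have mF : measurable_fun setT F.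
  apply/measurable_EFinP; apply: measurable_fun_ifT => //.
    by apply: measurable_and; apply: measurable_fun_ler.
  apply: measurable_funM.
    by apply: (measurableT_comp (measurable_powR _)).
  apply: measurable_funM => //.
  by apply: (measurableT_comp (measurable_normal_pdf _ _)).
have F0 z : (0 <= F z)%E.
  rewrite lee_fin; case: ifP => // /andP[z0 z12].
  by rewrite mulr_ge0 ?powR_ge0// mulr_ge0 ?normal_pdf_ge0// (le_trans z0).
have E1 : (\int[lam]_x \int[lam]_u F (x, u) =
    \int[lam]_(x in `[0%R, +oo[) (x `^ s * phi x)%:E)%E.
  rewrite [RHS]integral_mkcond; apply: eq_integral => x _; rewrite patchE.
  case: ifPn; rewrite ?inE ?notin_setE/= in_itv/= andbT => x0; last first.
    by apply: integral0_eq => u _; rewrite /F/= (negbTE (introN idP x0)).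
  have Hx : (\int[lam]_(u in `[x, +oo[) ((x `^ s)%:E * (u * phi u)%:E) = (x `^ s * phi x)%:E)%E.
    rewrite EFinM -(integral_normal_pdf_tail x0); apply: ge0_integralZl => //.
    - apply/measurable_EFinP/measurable_funTS; apply: measurable_funM => //.
      exact: measurable_normal_pdf.
    - by move=> u; rewrite /= in_itv/= andbT => xu; rewrite lee_fin mulr_ge0 ?normal_pdf_ge0 ?(le_trans x0).
    - by rewrite lee_fin powR_ge0.
  rewrite -Hx.
  rewrite [RHS]integral_mkcond; apply: eq_integral => u _; rewrite patchE /F/= x0/=.
  by rewrite mem_setE in_itv/= andbT; case: ifP.
have E2 : (\int[lam]_u \int[lam]_x F (x, u) =
    \int[lam]_(u in `[0%R, +oo[) ((s + 1)^-1 * (u `^ (s + 2) * phi u))%:E)%E.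
  rewrite [RHS]integral_mkcond; apply: eq_integral => u _; rewrite patchE.
  have [u0|u0] := leP u 0.
    rewrite (_ : (if _ then _ else _) = 0%E); last first.
      case: ifPn => //; rewrite inE/= in_itv/= andbT => u0'.
      have -> : u = 0 by apply/eqP; rewrite eq_le u0.
      by rewrite powR0 ?mul0r ?mulr0// gt_eqF// ltr_wpDl.
    apply: integral0_eq => x _; rewrite /F/=; case: ifPn => // /andP[x0 xu].
    have -> : u = 0 by apply/eqP; rewrite eq_le u0 (le_trans x0).
    by rewrite mul0r mulr0.
  rewrite ifT; last by rewrite inE/= in_itv/= andbT ltW.
  transitivity (\int[lam]_(x in `[0%R, u]) ((u * phi u)%:E * (x `^ s)%:E))%E.
    rewrite [RHS]integral_mkcond; apply: eq_integral => x _; rewrite patchE /F/=.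
    by rewrite mem_setE in_itv/=; case: ifP => // _; rewrite -EFinM mulrC.
  apply: etrans.
    apply: ge0_integralZl => //.
    - by apply/measurable_EFinP/measurable_funTS; exact: measurable_powR.
    - by move=> x _; rewrite lee_fin powR_ge0.
    - by rewrite lee_fin mulr_ge0 ?normal_pdf_ge0// ltW.
  rewrite integral_powR_itv0// -EFinM; congr EFin.
  rewrite (_ : s + 2 = s + 1 + 1); last by ring.
  rewrite (powRD (r := s + 1) (s := 1)); last by rewrite (gt_eqF u0) implybT.
  by rewrite (powRr1 (ltW u0)); field; rewrite gt_eqF.
have E3 : (\int[lam]_x \int[lam]_u F (x, u) = \int[lam]_u \int[lam]_x F (x, u))%E.
  exact: fubini_tonelli.
have E4 : (\int[lam]_(u in `[0%R, +oo[) ((s + 1)^-1 * (u `^ (s + 2) * phi u))%:E =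
    (s + 1)^-1%:E * \int[lam]_(u in `[0%R, +oo[) (u `^ (s + 2) * phi u)%:E)%E.
  have c0 : (0 <= (s + 1)^-1%:E)%E by rewrite lee_fin invr_ge0 ltW.
  pose f (u : T) := (u `^ (s + 2) * phi u)%:E.
  have mf : measurable_fun (`[0%R, +oo[%classic : set T) f.
    apply/measurable_EFinP/measurable_funTS; apply: measurable_funM; last exact: measurable_normal_pdf.
    exact: measurable_powR.
  have f0 (x : T) : (`[0%R, +oo[%classic : set T) x -> (0 <= f x)%E.
    by move=> _; rewrite lee_fin mulr_ge0 ?powR_ge0 ?normal_pdf_ge0.
  exact: (ge0_integralZl lam (measurable_itv `[0%R : R, +oo[) mf f0 c0).
have E5 := etrans (esym E4) (etrans (esym E2) (etrans (esym E3) E1)).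
exact: (etrans (E6 _) (congr1 (mule (s + 1)%:E) E5)).
Qed.

Definition absmom (s : R) : \bar R := (\int[gauss1 R]_z (`|z| `^ s)%:E)%E.

Lemma measurable_abs_powR (s : R) : measurable_fun setT (fun z : T => `|z| `^ s).
Proof.
have mn : measurable_fun setT (fun z : T => `|z| : R) by exact: measurableT_comp.
exact: (measurableT_comp (measurable_powR s) mn).
Qed.

Lemma absmomE (s : R) :
  (absmom s = 2%:E * \int[lam]_(x in `[0%R, +oo[) (x `^ s * phi x)%:E)%E.
Proof.
have mphi := measurable_normal_pdf (0 : R) 1.
pose f (z : T) := (`|z| `^ s * phi z)%:E.
have mf : measurable_fun setT f.
  by apply/measurable_EFinP; apply: measurable_funM => //; exact: measurable_abs_powR.
have f0 z : (0 <= f z)%E by rewrite lee_fin mulr_ge0 ?powR_ge0 ?normal_pdf_ge0.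
transitivity (\int[lam]_z f z)%E.
  apply: etrans.
    apply: ge0_integral_normal_prob; last by move=> x; rewrite lee_fin powR_ge0.
    by apply/measurable_EFinP; exact: measurable_abs_powR.
  by apply: eq_integral => z _; rewrite -EFinM.
have fN z : f (- z) = f z.
  by rewrite /f normrN !normal_pdf01 sqrrN.
have Hp : (\int[lam]_(x in `[0%R, +oo[) f x = \int[lam]_(x in `[0%R, +oo[) (x `^ s * phi x)%:E)%E.
  by apply: eq_integral => x; rewrite inE/= in_itv/= andbT => x0; rewrite /f ger0_norm.
have Hn : (\int[lam]_(x in `]-oo, 0%R]) f x = \int[lam]_(x in `[0%R, +oo[) f x)%E.
  rewrite ge0_integration_by_substitution0//.
  by apply: eq_integral => x _; rewrite fN.
have -> : [set: T] = `]-oo, 0%R] `|` `]0%R, +oo[.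
  by rewrite -setCitvl setUv.
rewrite ge0_integral_setU//=; last 2 first.
- exact: measurable_funTS.
- apply/disj_set2P; rewrite -subset0 => x [] /=; rewrite !in_itv/= andbT => a b.
  by move: (lt_le_trans b a); rewrite ltxx.
rewrite Hn (@integral_itv_obnd_cbnd _ 0 _ f); last exact: measurable_funTS.
rewrite Hp mule_natl mule2n; reflexivity.
Qed.

Lemma absmom_rec (s : R) : 0 <= s -> (absmom (s + 2) = (s + 1)%:E * absmom s)%E.
Proof. move=> s0; rewrite !absmomE; apply: etrans; last exact: muleCA.
by congr (_ * _)%E; exact: half_moment_rec. Qed.

End moments1.

(** * Means carried with their integrability *)
Section mean.
Set Implicit Arguments.
Unset Strict Implicit.
Context (R : realType).

(** Bundling integrability with the value makes linearity and products usable
    with no side conditions. *)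
Definition mean_is d (T : measurableType d) (mu : {measure set T -> \bar R}) (f : T -> R) (v : R) :=
  mu.-integrable setT (EFin \o f) /\ \int[mu]_x f x = v.

Section basic.
Context d (T : measurableType d) (mu : {measure set T -> \bar R}).
Implicit Types f h : T -> R.

Lemma mean_is_integral f v : mean_is mu f v -> (\int[mu]_x (f x)%:E = v%:E)%E.
Proof. by move=> [fi <-]; rewrite /Rintegral fineK//; exact: integrable_fin_num. Qed.

Lemma mean_isP f v : mu.-integrable setT (EFin \o f) -> (\int[mu]_x (f x)%:E = v%:E)%E ->
  mean_is mu f v.
Proof. by move=> fi fv; split => //; rewrite /Rintegral fv. Qed.

Lemma ge0_mean_is f v : measurable_fun setT f -> (forall x, 0 <= f x) ->
  (\int[mu]_x (f x)%:E = v%:E)%E -> mean_is mu f v.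
Proof.
move=> mf f0 fv; apply: mean_isP => //; apply/integrableP; split; first exact/measurable_EFinP.
by under eq_integral do rewrite gee0_abs ?lee_fin//; rewrite fv ltry.
Qed.

Lemma mean_is_ext f h v : f =1 h -> mean_is mu f v -> mean_is mu h v.
Proof. by move=> /funext ->. Qed.

Lemma mean_isD f h a b : mean_is mu f a -> mean_is mu h b ->
  mean_is mu (fun x => f x + h x) (a + b).
Proof.
move=> [fi <-] [hi <-]; split; last by rewrite RintegralD.
exact: (integrableD measurableT fi hi).
Qed.

Lemma mean_isZ f a c : mean_is mu f a -> mean_is mu (fun x => c * f x) (c * a).
Proof.
move=> [fi <-]; split; last by rewrite RintegralZl.
exact: (integrableZl measurableT c fi).
Qed.

Lemma mean_is0 : mean_is mu (fun=> 0) 0.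
Proof. by split; [exact: integrable0|rewrite Rintegral_cst// mul0r]. Qed.

Lemma mean_is_sum (I : Type) (s : seq I) (f : I -> T -> R) (a : I -> R) :
  (forall i, mean_is mu (f i) (a i)) ->
  mean_is mu (fun x => \sum_(i <- s) f i x) (\sum_(i <- s) a i).
Proof.
move=> fa; elim: s => [|i s ih].
  by rewrite big_nil; apply: mean_is_ext mean_is0 => x; rewrite big_nil.
by rewrite big_cons; apply: mean_is_ext (mean_isD (fa i) ih) => x; rewrite big_cons.
Qed.

Lemma le_mean f h a b : mean_is mu f a -> mean_is mu h b -> (forall x, f x <= h x) -> a <= b.
Proof. by move=> [fi <-] [hi <-] fh; apply: le_Rintegral => // x _; exact: fh. Qed.

Lemma mean_is_unique f a b : mean_is mu f a -> mean_is mu f b -> a = b.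
Proof. by move=> [_ <-] [_ <-]. Qed.
End basic.

Section product.
Context d1 d2 (T1 : measurableType d1) (T2 : measurableType d2).
Context (m1 : {sigma_finite_measure set T1 -> \bar R}) (m2 : {sigma_finite_measure set T2 -> \bar R}).

Lemma mean_is_iter (F : T1 * T2 -> R) (G : T1 -> R) v :
  (m1 \x m2)%E.-integrable setT (EFin \o F) ->
  (forall x, mean_is m2 (fun y => F (x, y)) (G x)) -> mean_is m1 G v ->
  mean_is (m1 \x m2)%E F v.
Proof.
move=> Fi FG Gv; apply: mean_isP => //.
apply: etrans; first by apply/esym; exact: integral12_prod_meas1.
rewrite -(mean_is_integral Gv); apply: eq_integral => x _.
exact: mean_is_integral.
Qed.

Lemma mean_isM (f : T1 -> R) (h : T2 -> R) a b : mean_is m1 f a -> mean_is m2 h b ->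
  mean_is (m1 \x m2)%E (fun z => f z.1 * h z.2) (a * b).
Proof.
move=> fa hb; have [fi _] := fa; have [hi _] := hb.
have mf : measurable_fun setT f by apply/measurable_EFinP; exact: (measurable_int m1).
have mh : measurable_fun setT h by apply/measurable_EFinP; exact: (measurable_int m2).
apply: (@mean_is_iter _ (fun x => b * f x)); last by rewrite mulrC; exact: mean_isZ.
  apply/integrable12ltyP.
    apply/measurable_EFinP; apply: measurable_funM.
      exact: (measurableT_comp mf measurable_fst).
    exact: (measurableT_comp mh measurable_snd).
  have /integrableP[_ fioo] := fi; have /integrableP[_ hioo] := hi.
  rewrite (_ : (\int[m1]_x _)%E = (\int[m1]_x `|(f x)%:E| * \int[m2]_x `|(h x)%:E|)%E).
    apply: lte_mul_pinfty => //; first exact: integral_ge0.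
    by rewrite ge0_fin_numE//; exact: integral_ge0.
  rewrite -ge0_integralZr//; last 2 first.
  - by apply: measurableT_comp => //; exact/measurable_EFinP.
  - exact: integral_ge0.
  apply: eq_integral => x _; rewrite -ge0_integralZl//; last first.
    by apply: measurableT_comp => //; exact/measurable_EFinP.
  by apply: eq_integral => y _ /=; rewrite normrM.
by move=> x; rewrite (mulrC b); exact: (mean_isZ (f x) hb).
Qed.
End product.
End mean.

Section moments2.
Set Implicit Arguments.
Unset Strict Implicit.
Context (R : realType).
Local Notation T := (measurableTypeR R).
Local Notation g := (gauss1 R).

Lemma absmom0 : absmom (0 : R) = 1%E.
Proof.
rewrite /absmom; under eq_integral do rewrite powRr0.
by rewrite integral_cst// mul1e; exact: probability_setT.
Qed.

Lemma absmom_ge0 (s : R) : (0 <= absmom s)%E.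
Proof. by apply: integral_ge0 => z _; rewrite lee_fin powR_ge0. Qed.

Lemma absmom_even_lty k : (absmom (k.*2%:R : R) < +oo)%E.
Proof.
elim: k => [|k ih]; first by rewrite absmom0 ltry.
rewrite doubleS -addn2 natrD absmom_rec// lte_mul_pinfty// ?lee_fin ?addr_ge0//.
Qed.

(** |z|^s <= 1 + |z|^(2k) for any integer k with s <= 2k, and even moments are
    finite by the recursion. *)
Lemma absmom_lty (s : R) : 0 <= s -> (absmom s < +oo)%E.
Proof.
move=> s0; have [k sk] : exists k : nat, s <= k.*2%:R.
  exists (Num.bound s); rewrite (le_trans (ltW (archi_boundP s0)))// ler_nat -addnn leq_addr//.
apply: (@le_lt_trans _ _ (1 + absmom (k.*2%:R : R))%E); last by rewrite lte_add_pinfty ?ltry// absmom_even_lty.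
have mp (t : R) : measurable_fun setT (fun z : T => (`|z| `^ t)%:E).
  by apply/measurable_EFinP; exact: measurable_abs_powR.
have p0 (t : R) (z : T) : (0 <= (`|z| `^ t)%:E)%E by rewrite lee_fin powR_ge0.
have <- : (\int[g]_z ((`|z| `^ 0)%:E + (`|z| `^ k.*2%:R)%:E) = 1 + absmom (k.*2%:R : R))%E.
  rewrite -[in RHS]absmom0; apply: ge0_integralD => //; exact: mp.
apply: (@ge0_le_integral _ _ _ g setT measurableT _ _ (fun z _ => p0 s z) (mp s)
  (emeasurable_funD (mp 0) (mp k.*2%:R))).
move=> z _; rewrite -EFinD lee_fin powRr0.
have [z1|z1] := leP `|z| 1.
  rewrite (@le_trans _ _ 1)//; last by rewrite lerDl powR_ge0.
  by have := @ge0_ler_powR _ s s0 `|z| 1; rewrite powR1; apply => //; rewrite nnegrE.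
by rewrite (@le_trans _ _ (`|z| `^ k.*2%:R))// ?ler_powR ?lerDr// ltW.
Qed.

Definition mom (s : R) : R := fine (absmom s).

Lemma momE s : 0 <= s -> absmom s = (mom s)%:E.
Proof. by move=> s0; rewrite /mom fineK// ge0_fin_numE ?absmom_lty ?absmom_ge0. Qed.

Lemma mom0 : mom 0 = 1. Proof. by rewrite /mom absmom0. Qed.

Lemma mom_rec s : 0 <= s -> mom (s + 2) = (s + 1) * mom s.
Proof.
move=> s0; apply: EFin_inj; rewrite -momE ?addr_ge0//.
by rewrite EFinM -(momE s0) absmom_rec.
Qed.

Lemma mean_is_mom s : 0 <= s -> mean_is g (fun z : T => `|z| `^ s) (mom s).
Proof.
move=> s0; apply: ge0_mean_is; last exact: momE.
  exact: measurable_abs_powR.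
by move=> z; rewrite powR_ge0.
Qed.

(** z^2 <= 3^(2-s) |z|^s where |z| <= 3, and z^2 <= z^4 / 9 elsewhere; as the
    second and fourth moments are 1 and 3, the s-th moment exceeds a positive
    constant. *)
Lemma mom_gt0 s : 0 <= s <= 2 -> 0 < mom s.
Proof.
move=> /andP[s0 s2]; have m2 : mom 2 = 1 by rewrite -[2]add0r mom_rec// mom0 add0r mul1r.
have m4 : mom 4 = 3 by rewrite (_ : 4 = 2 + 2 :> R) ?mom_rec ?m2//; lra.
have : mom 2 <= 3 `^ (2 - s) * mom s + 9^-1 * mom 4.
  apply: (le_mean (mean_is_mom _) (mean_isD (mean_isZ _ (mean_is_mom s0)) (mean_isZ 9^-1 (mean_is_mom _)))) => // z.
  rewrite !powR_mulrn//; have [z3|z3] := leP `|z| 3.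
    rewrite (@le_trans _ _ (3 `^ (2 - s) * `|z| `^ s))//; last by rewrite lerDl mulr_ge0// exprn_ge0.
    have [->|z0] := eqVneq `|z| 0; first by rewrite expr0n/= mulr_ge0 ?powR_ge0.
    rewrite -(@powR_mulrn _ `|z| 2)// -[in leLHS](subrK s 2) powRD ?z0 ?implybT//.
    by rewrite ler_wpM2r ?powR_ge0// ge0_ler_powR ?nnegrE// subr_ge0.
  rewrite (@le_trans _ _ (9^-1 * `|z| ^+ 4))//; last by rewrite lerDr mulr_ge0 ?powR_ge0.
  have h9 : 9 <= `|z| ^+ 2 by nra.
  rewrite (exprD _ 2 2) mulrA ler_peMl ?exprn_ge0//; lra.
rewrite m2 m4 => h; have : 0 < 3 `^ (2 - s) * mom s by lra.
by rewrite pmulr_rgt0// powR_gt0.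
Qed.

Lemma ge0_integral_gauss1N (F : T -> \bar R) : measurable_fun setT F -> (forall x, 0 <= F x)%E ->
  (\int[g]_z F (- z)%R = \int[g]_z F z)%E.
Proof.
move=> mF F0.
have mN : measurable_fun setT (-%R : T -> T) by exact: measurable_funN.
have mFN := measurableT_comp mF mN.
apply: etrans; first exact: (@ge0_integral_normal_prob R (F \o -%R) mFN (fun z => F0 (- z))).
apply: etrans; last by apply/esym; exact: (ge0_integral_normal_prob R F mF F0).
have mphi := measurable_normal_pdf (0 : R) 1.
pose G (z : T) := (F z * (normal_pdf 0 1 z)%:E)%E.
have mG : measurable_fun setT G by apply: emeasurable_funM => //; exact/measurable_EFinP.
have G0 z : (0 <= G z)%E by rewrite mule_ge0// lee_fin normal_pdf_ge0.
transitivity (\int[lebesgue_measure]_z (G \o -%R) z)%E.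
  by apply: eq_integral => z _; rewrite /G/= !normal_pdf01 sqrrN.
have := @ge0_integral_pushforward _ _ _ _ R _ mN lebesgue_measure setT G measurableT mG.
rewrite preimage_setT => <-; last by move=> x _; exact: G0.
by apply: eq_measure_integral => A mA _; exact: lebesgue_measureN.
Qed.

Lemma integral_gauss1_odd (f : T -> R) : measurable_fun setT f -> (forall z, f (- z) = - f z) ->
  \int[g]_z f z = 0.
Proof.
move=> mf fN; rewrite /Rintegral integralE.
suff -> : (\int[g]_x (EFin \o f)^\- x = \int[g]_x (EFin \o f)^\+ x)%E.
  by case: (integral _ _ _) => [r| |] //=; rewrite subrr.
have me : measurable_fun setT (EFin \o f) by exact/measurable_EFinP.
rewrite -[RHS]ge0_integral_gauss1N//; last exact: measurable_funepos.
by apply: eq_integral => x _; rewrite funeposE funenegE /= fN.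
Qed.
End moments2.

(** * Hermite polynomials against powers of the absolute value *)
Section hermite.
Set Implicit Arguments.
Unset Strict Implicit.
Context (R : realType).
Local Notation T := (measurableTypeR R).
Local Notation g := (gauss1 R).
Local Notation gauss2 := (gauss2 R).
Local Notation gauss3 := (gauss3 R).
Implicit Types (s v b : R) (p r : {poly R}).

(** E |z|^s z^n for a standard Gaussian z. *)
Definition momn s n : R := if odd n then 0 else mom (s + n%:R).

Lemma momn_rec s n : 0 <= s -> momn s n.+2 = (s + n%:R + 1) * momn s n.
Proof.
move=> s0; rewrite /momn/= negbK; case: ifP => _; first by rewrite mulr0.
by rewrite -addn2 natrD addrA mom_rec// addr_ge0.
Qed.

Lemma powR_mul_expr s n (z : R) : 0 <= s -> `|z| `^ s * `|z| ^+ n = `|z| `^ (s + n%:R).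
Proof.
move=> s0; rewrite -powR_mulrn//; have [->|z0] := eqVneq `|z| 0; last by rewrite powRD// z0 implybT.
have [->|n0] := eqVneq n 0; first by rewrite powRr0 mulr1 addr0.
by rewrite [X in _ * X]powR0 ?pnatr_eq0// mulr0 powR0// gt_eqF// ltr_wpDl// ltr0n lt0n.
Qed.

Lemma mean_is_momn s n : 0 <= s -> mean_is g (fun z : T => `|z| `^ s * z ^+ n) (momn s n).
Proof.
move=> s0; have sn0 : 0 <= s + n%:R by rewrite addr_ge0.
have mf : measurable_fun setT (fun z : T => `|z| `^ s * z ^+ n).
  by apply: measurable_funM; [exact: measurable_abs_powR|exact: measurable_funX].
rewrite /momn; case: ifPn => on.
  split; last first.
    apply: integral_gauss1_odd => // z.
    by rewrite normrN exprNn -signr_odd on expr1 mulN1r mulrN.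
  have [hi _] := mean_is_mom sn0.
  apply: le_integrable hi => //; first exact/measurable_EFinP.
  move=> z _ /=; rewrite lee_fin normrM normrX -powR_mul_expr//.
  by rewrite normrM (ger0_norm (powR_ge0 _ _)) normrX normr_id.
apply: mean_is_ext (mean_is_mom sn0) => z.
rewrite -powR_mul_expr//; congr (_ * _).
by rewrite -normrX ger0_norm// exprn_even_ge0.
Qed.

(** E |z|^s p(z) for a standard Gaussian z, a linear form in p. *)
Definition wmoment s p : R := \sum_(i < size p) p`_i * momn s i.

Lemma mean_is_wmoment s p : 0 <= s -> mean_is g (fun z : T => `|z| `^ s * p.[z]) (wmoment s p).
Proof.
move=> s0; apply: (@mean_is_ext _ _ _ g (fun z : T => \sum_(i < size p) p`_i * (`|z| `^ s * z ^+ i))).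
  by move=> z; rewrite horner_coef mulr_sumr; apply: eq_bigr => i _; rewrite mulrCA.
by apply: mean_is_sum => i; apply: mean_isZ; exact: mean_is_momn.
Qed.

Lemma wmomentD s p r : 0 <= s -> wmoment s (p + r) = wmoment s p + wmoment s r.
Proof.
move=> s0; apply: (mean_is_unique (mean_is_wmoment _ s0)).
by apply: mean_is_ext (mean_isD (mean_is_wmoment p s0) (mean_is_wmoment r s0)) => z; rewrite hornerD mulrDr.
Qed.

Lemma wmomentZ s c p : 0 <= s -> wmoment s (c *: p) = c * wmoment s p.
Proof.
move=> s0; apply: (mean_is_unique (mean_is_wmoment _ s0)).
by apply: mean_is_ext (mean_isZ c (mean_is_wmoment p s0)) => z; rewrite hornerZ mulrCA.
Qed.

Lemma wmomentB s p r : 0 <= s -> wmoment s (p - r) = wmoment s p - wmoment s r.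
Proof. by move=> s0; rewrite wmomentD// -scaleN1r wmomentZ// mulN1r. Qed.

Lemma wmomentXn s n : 0 <= s -> wmoment s 'X^n = momn s n.
Proof.
move=> s0; apply: (mean_is_unique (mean_is_wmoment _ s0)).
by apply: mean_is_ext (mean_is_momn n s0) => z; rewrite hornerXn.
Qed.

Lemma wmoment1 s : 0 <= s -> wmoment s 1 = mom s.
Proof. by move=> s0; rewrite -(expr0 'X) wmomentXn// /momn/= addr0. Qed.

Lemma poly_linear_ext (f h : {poly R} -> R) :
  {morph f : p r / p + r} -> {morph h : p r / p + r} ->
  (forall c p, f (c *: p) = c * f p) -> (forall c p, h (c *: p) = c * h p) ->
  (forall n, f 'X^n = h 'X^n) -> f =1 h.
Proof.
move=> fD hD fZ hZ fh p.
have f0 : f 0 = 0 by rewrite -[0 in LHS](scale0r 0) fZ mul0r.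
have h0 : h 0 = 0 by rewrite -[0 in LHS](scale0r 0) hZ mul0r.
rewrite -(coefK p) poly_def (big_morph f fD f0) (big_morph h hD h0).
by apply: eq_bigr => i _; rewrite fZ hZ fh.
Qed.

(** Gaussian integration by parts; on monomials it is the moment recursion. *)
Lemma wmoment0_stein p : wmoment 0 ('X * p) = wmoment 0 p^`().
Proof.
apply: (poly_linear_ext (f := fun p => wmoment 0 ('X * p)) (h := fun p => wmoment 0 p^`())).
- by move=> a c /=; rewrite mulrDr wmomentD.
- by move=> a c /=; rewrite derivD wmomentD.
- by move=> c a; rewrite -scalerAr wmomentZ.
- by move=> c a; rewrite derivZ wmomentZ.
move=> n; rewrite -exprS derivXn wmomentXn// -scaler_nat wmomentZ// wmomentXn//.
by case: n => [|n] /=; rewrite ?mul0r// momn_rec// add0r -natr1.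
Qed.

(** Integration by parts against |z|^s z, where the weight contributes its
    degree: the derivative of |z|^s z is (s+1) |z|^s. *)
Lemma wmoment_euler s p : 0 <= s -> wmoment s ('X^2 * p) = (s + 1) * wmoment s p + wmoment s ('X * p^`()).
Proof.
move=> s0; apply: (poly_linear_ext (f := fun p => wmoment s ('X^2 * p))
  (h := fun p => (s + 1) * wmoment s p + wmoment s ('X * p^`()))).
- by move=> a c /=; rewrite mulrDr wmomentD.
- by move=> a c /=; rewrite derivD mulrDr !wmomentD//; ring.
- by move=> c a; rewrite -scalerAr wmomentZ.
- by move=> c a; rewrite derivZ -scalerAr !wmomentZ// mulrDr mulrCA.
move=> n; rewrite -exprD add2n derivXn -scaler_nat -scalerAr wmomentZ// !wmomentXn// momn_rec//.
case: n => [|n]; first by rewrite mul0r !addr0.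
by rewrite -exprS wmomentXn//; ring.
Qed.

(** The probabilists' polynomials, orthogonal for the standard Gaussian. *)
Fixpoint hermite n : {poly R} :=
  if n is m.+1 then 'X * hermite m - (hermite m)^`() else 1.

Lemma deriv_hermite n : (hermite n.+1)^`() = n.+1%:R *: hermite n.
Proof.
elim: n => [|n ih]; first by rewrite /= derivB derivM derivX -polyC1 !derivC mulr0 addr0 subr0 mul1r scale1r.
rewrite -/(hermite n.+1) [hermite n.+2]/= -/(hermite n.+1) derivB derivM derivX mul1r.
rewrite ih derivZ -scalerAr -addrA -scalerBr -[X in _ *: X]/(hermite n.+1).
by rewrite -[n.+2%:R]natr1 scalerDl scale1r addrC.
Qed.

(** In He_(n+2) = X^2 He_n - X He_n' - (n+1) He_n the derivative term cancels
    against that of [wmoment_euler]. *)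
Lemma wmoment_hermiteSS s n : 0 <= s -> wmoment s (hermite n.+2) = (s - n%:R) * wmoment s (hermite n).
Proof.
move=> s0.
have -> : hermite n.+2 = 'X^2 * hermite n - 'X * (hermite n)^`() - n.+1%:R *: hermite n.
  rewrite [LHS]/= -/(hermite n.+1) deriv_hermite; congr (_ - _).
  by rewrite /= mulrBr mulrA -expr2.
rewrite !wmomentB// wmomentZ// wmoment_euler// -natr1; ring.
Qed.

(** The product vanishes only for an even integer s; for q in (0, 2) no even
    Hermite polynomial is therefore lost in the duality argument. *)
Lemma wmoment_hermite_even s m : 0 <= s -> wmoment s (hermite m.*2) = (\prod_(i < m) (s - i.*2%:R)) * mom s.
Proof.
move=> s0; elim: m => [|m ih].
  by rewrite big_ord0 mul1r /= wmoment1.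
by rewrite doubleS wmoment_hermiteSS// ih big_ord_recr/= mulrA (mulrC (s - _)).
Qed.

(** He_n is an eigenfunction, of eigenvalue v^n, of the operator
    f |-> E_w f(v z + b w) with w Gaussian.  The induction also carries the
    derivative, which the Stein identity produces. *)
Lemma hermite_mehler v b z n : v ^+ 2 + b ^+ 2 = 1 ->
  wmoment 0 (hermite n \Po (b *: 'X + (v * z)%:P)) = v ^+ n * (hermite n).[z].
Proof.
move=> vb; set a := b *: 'X + _.
have da : a^`() = b%:P by rewrite derivD derivZ derivX derivC addr0 -mul_polyC mulr1.
suff: wmoment 0 (hermite n \Po a) = v ^+ n * (hermite n).[z] /\
   wmoment 0 ((hermite n)^`() \Po a) = v ^+ n.-1 * (hermite n)^`().[z] by case.
elim: n => [|n [ih1 ih2]].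
  rewrite /= -polyC1 derivC comp_polyC comp_poly0 horner0 hornerC mulr0 mulr1 polyC1.
  rewrite expr0 wmoment1// mom0; split => //.
  by rewrite -(subrr (0 : {poly R})) wmomentB// subrr.
split; last first.
  by rewrite deriv_hermite comp_polyZ wmomentZ// ih1 hornerZ/=; ring.
rewrite [hermite n.+1]/= comp_polyB comp_polyM comp_polyX wmomentB// {1}/a mulrDl wmomentD//.
rewrite -scalerAl wmomentZ// wmoment0_stein deriv_comp da mulrC -/a.
rewrite (_ : _ * b%:P = b *: ((hermite n)^`() \Po a)); last by rewrite mulrC mul_polyC.
rewrite wmomentZ// mul_polyC wmomentZ// ih1 ih2 hornerD hornerN hornerM hornerX.
case: n {ih1 ih2} => [|n].
  by rewrite /= -polyC1 derivC horner0; ring.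
apply/eqP; rewrite -subr_eq0 -[n.+1.-1]/n; set D := (_^`()).[z]; set H := (hermite n.+1).[z].
rewrite (_ : _ - _ = (v ^+ 2 + b ^+ 2 - 1) * (v ^+ n * D)); last by rewrite !exprS; ring.
by rewrite vb subrr mul0r.
Qed.

Lemma mean_is_hermite v b z n : v ^+ 2 + b ^+ 2 = 1 ->
  mean_is g (fun w : T => (hermite n).[v * z + b * w]) (v ^+ n * (hermite n).[z]).
Proof.
move=> vb; rewrite -(hermite_mehler z n vb).
apply: mean_is_ext (mean_is_wmoment _ (lexx 0)) => w.
by rewrite powRr0 mul1r horner_comp !hornerE addrC.
Qed.

Lemma mean_is_cst1 : mean_is g (fun=> 1) 1.
Proof.
have := mean_is_mom (lexx (0 : R)); rewrite mom0.
by apply: mean_is_ext => z; rewrite powRr0.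
Qed.

Lemma mean_isM_gauss2 (f h : T -> R) a b : mean_is g f a -> mean_is g h b ->
  mean_is gauss2 (fun z => f z.1 * h z.2) (a * b).
Proof. exact: (@mean_isM R _ _ T T g g). Qed.

Lemma mean_isM_gauss3 (f : T -> R) (h : T * T -> R) a b : mean_is g f a -> mean_is gauss2 h b ->
  mean_is gauss3 (fun z => f z.1 * h z.2) (a * b).
Proof. exact: (@mean_isM R _ _ T (T * T)%type g gauss2). Qed.

Lemma mean_is_iter_gauss3 (F : T * (T * T) -> R) (G : T -> R) a :
  gauss3.-integrable setT (EFin \o F) ->
  (forall x, mean_is gauss2 (fun y => F (x, y)) (G x)) -> mean_is g G a ->
  mean_is gauss3 F a.
Proof. exact: (@mean_is_iter R _ _ T (T * T)%type g gauss2). Qed.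

Lemma mean_is_mono3 s i j k : 0 <= s ->
  mean_is gauss3 (fun z : T * (T * T) => `|z.1| `^ s * z.1 ^+ i * (z.2.1 ^+ j * z.2.2 ^+ k))
    (momn s i * (momn 0 j * momn 0 k)).
Proof.
move=> s0.
have h n : mean_is g (fun z : T => z ^+ n) (momn 0 n).
  by apply: mean_is_ext (mean_is_momn n (lexx 0)) => z; rewrite powRr0 mul1r.
exact: (mean_isM_gauss3 (mean_is_momn i s0) (mean_isM_gauss2 (h j) (h k))).
Qed.

(** The expansion into monomials that makes a polynomial of a linear form
    integrable for the product measure. *)
Lemma horner_lin2 (a x y v b : R) p :
  \sum_(i < size p) \sum_(j < i.+1)
     (p`_i * ((v ^+ (i - j) * b ^+ j) *+ 'C(i, j))) * (a * x ^+ (i - j) * (y ^+ j * 1)) =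
  a * p.[v * x + b * y].
Proof.
rewrite horner_coef mulr_sumr; apply: eq_bigr => i _.
rewrite exprDn mulr_sumr mulr_sumr; apply: eq_bigr => j _.
by rewrite !exprMn -[in LHS]mulr_natr -[in RHS]mulr_natr; ring.
Qed.

Lemma integrable_poly3 s v b p : 0 <= s ->
  gauss3.-integrable setT (EFin \o (fun z : T * (T * T) => `|z.1| `^ s * p.[v * z.1 + b * z.2.1])).
Proof.
move=> s0.
have H : mean_is gauss3 (fun z => \sum_(i < size p) \sum_(j < i.+1)
   (p`_i * ((v ^+ (i - j) * b ^+ j) *+ 'C(i, j))) * (`|z.1| `^ s * z.1 ^+ (i - j) * (z.2.1 ^+ j * z.2.2 ^+ 0)))
   (\sum_(i < size p) \sum_(j < i.+1)
   (p`_i * ((v ^+ (i - j) * b ^+ j) *+ 'C(i, j))) * (momn s (i - j) * (momn 0 j * momn 0 0))).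
  by apply: mean_is_sum => i; apply: mean_is_sum => j; apply: mean_isZ; exact: mean_is_mono3.
by have [hi _] := mean_is_ext (fun z : T * (T * T) => horner_lin2 (`|z.1| `^ s) z.1 z.2.1 v b p) H.
Qed.

(** Integrating z.2 out first leaves v^n He_n(z.1) by [mean_is_hermite]. *)
Lemma mean_is_hermite3 s v b n : 0 <= s -> v ^+ 2 + b ^+ 2 = 1 ->
  mean_is gauss3 (fun z : T * (T * T) => `|z.1| `^ s * (hermite n).[v * z.1 + b * z.2.1])
    (v ^+ n * wmoment s (hermite n)).
Proof.
move=> s0 vb; apply: (@mean_is_iter_gauss3 _
   (fun x : T => v ^+ n * (`|x| `^ s * (hermite n).[x]))).
- exact: integrable_poly3.
- move=> x.
  have := mean_isZ (`|x| `^ s) (mean_isM_gauss2 (mean_is_hermite x n vb) mean_is_cst1).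
  rewrite mulr1 mulrCA; apply: mean_is_ext => w /=.
  by rewrite mulr1.
- by apply: mean_isZ; exact: mean_is_wmoment.
Qed.
End hermite.

(** * Powers of linear forms against zonal densities *)
Section space.
Set Implicit Arguments.
Unset Strict Implicit.
Context (R : realType).
Local Notation T := (measurableTypeR R).
Local Notation T3 := (T * (T * T))%type.
Local Notation g := (gauss1 R).
Local Notation gauss3 := (gauss3 R).
Implicit Types (x y z : T3) (q : R).

Definition dot3 (x y : T3) : R := x.1 * y.1 + x.2.1 * y.2.1 + x.2.2 * y.2.2.
Definition sqn3 (x : T3) : R := x.2.1 ^+ 2 + x.2.2 ^+ 2 + x.1 ^+ 2.
Definition nrm3 (x : T3) : R := Num.sqrt (sqn3 x).
(** The sine of the latitude; 0 at the origin, as division by 0 yields 0. *)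
Definition lat3 (x : T3) : R := x.1 / nrm3 x.

Lemma measurable_c1 : measurable_fun setT (fun x : T3 => x.1 : R).
Proof. exact: measurable_fst. Qed.
Lemma measurable_c2 : measurable_fun setT (fun x : T3 => x.2.1 : R).
Proof. exact: (measurableT_comp measurable_fst measurable_snd). Qed.
Lemma measurable_c3 : measurable_fun setT (fun x : T3 => x.2.2 : R).
Proof. exact: (measurableT_comp measurable_snd measurable_snd). Qed.

Lemma sqn3_ge0 x : 0 <= sqn3 x. Proof. by rewrite !addr_ge0 ?sqr_ge0. Qed.
Lemma nrm3_ge0 x : 0 <= nrm3 x. Proof. exact: sqrtr_ge0. Qed.
Lemma sqr_nrm3 x : nrm3 x ^+ 2 = sqn3 x. Proof. by rewrite sqr_sqrtr ?sqn3_ge0. Qed.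

Lemma nrm3_eq0 x : nrm3 x = 0 -> x = (0, (0, 0)).
Proof.
move=> x0; have : sqn3 x = 0 by rewrite -sqr_nrm3 x0 expr0n.
case: x {x0} => [a [b c]]; rewrite /sqn3/= => /eqP.
rewrite paddr_eq0 ?addr_ge0 ?sqr_ge0// paddr_eq0 ?sqr_ge0// !sqrf_eq0.
by move=> /andP[/andP[/eqP-> /eqP->] /eqP->].
Qed.

Lemma measurable_dot3 y : measurable_fun setT (fun x => dot3 x y).
Proof.
have [m1 m2 m3] := And3 measurable_c1 measurable_c2 measurable_c3.
by apply: measurable_funD; [apply: measurable_funD|]; apply: measurable_funM.
Qed.

Lemma measurable_sqn3 : measurable_fun setT sqn3.
Proof.
have [m1 m2 m3] := And3 measurable_c1 measurable_c2 measurable_c3.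
by apply: measurable_funD; [apply: measurable_funD|]; apply: measurable_funX.
Qed.

Lemma dot3C x y : dot3 x y = dot3 y x.
Proof. by rewrite /dot3 !(mulrC x.1) !(mulrC x.2.1) !(mulrC x.2.2). Qed.

Lemma preserving_mean (f : T3 -> T3) (F : T3 -> R) v :
  gauss3_preserving R f -> measurable_fun setT F ->
  mean_is gauss3 (F \o f) v -> mean_is gauss3 F v.
Proof.
move=> [mf pf] mF Fv; have me : measurable_fun setT (EFin \o F) by exact/measurable_EFinP.
apply: mean_isP.
  apply/integrableP; split => //.
  rewrite -pf//; last exact: measurableT_comp.
  by have [/integrableP[_]] := Fv.
rewrite -(mean_is_integral Fv).
apply: etrans; first exact: integralE.
apply: etrans; last by apply/esym; exact: integralE.
congr (_ - _)%E.
  apply/esym; apply: etrans; last by apply: (pf (EFin \o F)^\+%E) => //; exact: measurable_funepos.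
  by apply: eq_integral => z _; rewrite !funeposE.
apply/esym; apply: etrans; last by apply: (pf (EFin \o F)^\-%E) => //; exact: measurable_funeneg.
by apply: eq_integral => z _; rewrite !funenegE.
Qed.

Lemma measurable_abs_dot3 q y : measurable_fun setT (fun x => `|dot3 x y| `^ q).
Proof. exact: (measurableT_comp (@measurable_abs_powR R q) (measurable_dot3 y)). Qed.

Lemma gauss3_rotation_dot y : nrm3 y != 0 ->
  exists2 f : T3 -> T3, gauss3_preserving R f & forall z,
   [/\ dot3 (f z) y = nrm3 y * z.1,
       (f z).1 = lat3 y * z.1 - Num.sqrt (1 - lat3 y ^+ 2) * z.2.1 &
       sqn3 (f z) = sqn3 z].
Proof.
move=> y0; have [f pf fE] := gauss3_rotation R y.2.1 y.2.2 y.1 y0.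
exists f => // z; have [e1 e2 e3] := fE z; split => //.
  by rewrite dot3C.
by rewrite /sqn3 addrC addrA e3 [RHS]addrC addrA.
Qed.

Lemma lat3_sqr_le1 y : lat3 y ^+ 2 <= 1.
Proof.
rewrite /lat3 expr_div_n sqr_nrm3; have [->|y0] := eqVneq (sqn3 y) 0; first by rewrite invr0 mulr0.
by rewrite ler_pdivrMr ?lt_neqAle ?(eq_sym 0) ?y0 ?sqn3_ge0// mul1r lerDr addr_ge0 ?sqr_ge0.
Qed.

(** Rotating y to the polar axis turns the form <x, y> into |y| z.1 and x3 into
    v z.1 - b z.2.1 with v = lat3 y, and [mean_is_hermite3] applies. *)
Lemma mean_is_hermite_dot3 q n y : 0 < q ->
  mean_is gauss3 (fun x => `|dot3 x y| `^ q * (hermite R n).[x.1])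
    (nrm3 y `^ q * lat3 y ^+ n * wmoment q (hermite R n)).
Proof.
move=> q0; have q0' := ltW q0.
have [y0|y0] := eqVneq (nrm3 y) 0.
  rewrite y0 powR0 ?gt_eqF// !mul0r; apply: mean_is_ext (mean_is0 _) => x.
  by rewrite /dot3 (nrm3_eq0 y0)/= !mulr0 !addr0 normr0 powR0 ?gt_eqF// mul0r.
have [f pf fE] := gauss3_rotation_dot y0.
apply: (preserving_mean pf).
  apply: measurable_funM; first exact: measurable_abs_dot3.
  apply: (measurableT_comp _ measurable_c1).
  exact: measurable_poly.
set b := Num.sqrt (1 - lat3 y ^+ 2) in fE.
have vb : lat3 y ^+ 2 + (- b) ^+ 2 = 1.
  by rewrite sqrrN sqr_sqrtr ?subr_ge0 ?lat3_sqr_le1//; ring.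
have := mean_isZ (nrm3 y `^ q) (mean_is_hermite3 n q0' vb); rewrite mulrA.
apply: mean_is_ext => z /=; have [-> -> _] := fE z.
by rewrite normrM (ger0_norm (nrm3_ge0 y)) powRM ?nrm3_ge0// mulNr mulrA.
Qed.

(** The even zonal quartic forms. *)
Definition dens4 (A B C : R) (y : T3) : R :=
  A * sqn3 y ^+ 2 + B * (sqn3 y * y.1 ^+ 2) + C * y.1 ^+ 4.

Lemma measurable_dens4 A B C : measurable_fun setT (dens4 A B C).
Proof.
have m1 := measurable_c1; have ms := measurable_sqn3.
apply: measurable_funD; [apply: measurable_funD|]; apply: measurable_funM => //.
- exact: measurable_funX.
- by apply: measurable_funM => //; exact: measurable_funX.
- exact: measurable_funX.
Qed.

(** The monomials of [dens4] after the rotation, in which the polar coordinate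
    becomes u z.1 - b z.2.1: pairs of a coefficient and three exponents. *)
Definition mono_coefs (A B C u b : R) : seq (R * (nat * (nat * nat))) :=
  [:: (A + B * u ^+ 2 + C * u ^+ 4, (4, (0, 0))%N);
      (A + B * b ^+ 2 + C * b ^+ 4, (0, (4, 0))%N);
      (A, (0, (0, 4))%N);
      (2 * A + B * (u ^+ 2 + b ^+ 2) + 6 * C * u ^+ 2 * b ^+ 2, (2, (2, 0))%N);
      (2 * A + B * u ^+ 2, (2, (0, 2))%N);
      (2 * A + B * b ^+ 2, (0, (2, 2))%N);
      (- 2 * B * u * b - 4 * C * u ^+ 3 * b, (3, (1, 0))%N);
      (- 2 * B * u * b - 4 * C * u * b ^+ 3, (1, (3, 0))%N);
      (- 2 * B * u * b, (1, (1, 2))%N)].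

Lemma mono_coefsE (A B C u b a p r s : R) :
  \sum_(m <- mono_coefs A B C u b) m.1 * (a * p ^+ m.2.1 * (r ^+ m.2.2.1 * s ^+ m.2.2.2)) =
  a * (A * (r ^+ 2 + s ^+ 2 + p ^+ 2) ^+ 2 + B * ((r ^+ 2 + s ^+ 2 + p ^+ 2) * (u * p - b * r) ^+ 2)
       + C * (u * p - b * r) ^+ 4).
Proof. by rewrite /mono_coefs !big_cons big_nil/=; ring. Qed.

Lemma mono_coefs_mean (A B C u b q : R) : 0 <= q -> u ^+ 2 + b ^+ 2 = 1 ->
  \sum_(m <- mono_coefs A B C u b) m.1 * (momn q m.2.1 * (momn 0 m.2.2.1 * momn 0 m.2.2.2)) =
  mom q * (A * (q + 3) * (q + 5) + B * (q + 5) * (1 + q * u ^+ 2) +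
    C * (3 + 6 * q * u ^+ 2 + q * (q - 2) * u ^+ 4)).
Proof.
move=> q0 ub; have b2 : b ^+ 2 = 1 - u ^+ 2 by rewrite -ub; ring.
have b4 : b ^+ 4 = (1 - u ^+ 2) ^+ 2 by rewrite -b2; ring.
have k0 (s : R) : momn s 0 = mom s by rewrite /momn addr0.
have k2 (s : R) : 0 <= s -> momn s 2 = (s + 1) * mom s by move=> s0; rewrite momn_rec// k0 addr0.
have k4 (s : R) : 0 <= s -> momn s 4 = (s + 3) * ((s + 1) * mom s).
  by move=> s0; rewrite momn_rec// k2//; congr (_ * _); ring.
have k1 (s : R) : momn s 1 = 0 by [].
have k3 (s : R) : momn s 3 = 0 by [].
rewrite /mono_coefs !big_cons big_nil/= !k1 !k3 !k4// !k2// !k0 mom0 b2 b4; ring.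
Qed.

(** Rotate x to the polar axis and take moments of the monomials; those of odd
    degree in a coordinate vanish. *)
Lemma mean_is_dens4 (A B C q : R) x : 0 < q ->
  mean_is gauss3 (fun y => `|dot3 y x| `^ q * dens4 A B C y)
    (mom q * nrm3 x `^ q * (A * (q + 3) * (q + 5) + B * (q + 5) * (1 + q * lat3 x ^+ 2) +
    C * (3 + 6 * q * lat3 x ^+ 2 + q * (q - 2) * lat3 x ^+ 4))).
Proof.
move=> q0; have q0' := ltW q0.
have [y0|y0] := eqVneq (nrm3 x) 0.
  rewrite y0 powR0 ?gt_eqF// mulr0 !mul0r; apply: mean_is_ext (mean_is0 _) => y.
  by rewrite /dot3 (nrm3_eq0 y0)/= !mulr0 !addr0 normr0 powR0 ?gt_eqF// mul0r.
have [f pf fE] := gauss3_rotation_dot y0.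
apply: (preserving_mean pf).
  apply: measurable_funM; [exact: measurable_abs_dot3|exact: measurable_dens4].
set u := lat3 x in fE *; set b := Num.sqrt (1 - u ^+ 2) in fE.
have ub : u ^+ 2 + b ^+ 2 = 1.
  by rewrite sqr_sqrtr ?subr_ge0 ?lat3_sqr_le1//; ring.
have H := mean_is_sum (mono_coefs A B C u b) (fun m : R * (nat * (nat * nat)) => mean_isZ m.1 (mean_is_mono3 m.2.1 m.2.2.1 m.2.2.2 q0')).
rewrite [mom q * _]mulrC -[X in mean_is _ _ X]mulrA -(mono_coefs_mean A B C q0' ub).
apply: mean_is_ext (mean_isZ (nrm3 x `^ q) H) => z /=; have [-> e1 e2] := fE z.
rewrite /dens4 e1 e2 (mono_coefsE A B C u b (`|z.1| `^ q) z.1 z.2.1 z.2.2).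
by rewrite normrM (ger0_norm (nrm3_ge0 x)) powRM ?nrm3_ge0// mulrA.
Qed.
End space.

(** * From an embedding to the moments of a zonal density *)
Section duality.
Set Implicit Arguments.
Unset Strict Implicit.
Context (R : realType).
Local Notation T := (measurableTypeR R).
Local Notation T3 := (T * (T * T))%type.
Local Notation g := (gauss1 R).
Local Notation gauss3 := (gauss3 R).

Definition mono3 (m : nat * (nat * nat)) (z : T3) : R := z.1 ^+ m.1 * (z.2.1 ^+ m.2.1 * z.2.2 ^+ m.2.2).

(** Polynomial functions through an explicit list of monomials: integrability
    is then immediate, and closure under ring operations easy. *)
Definition is_poly3 (F : T3 -> R) :=
  exists s : seq (R * (nat * (nat * nat))), forall z, F z = \sum_(m <- s) m.1 * mono3 m.2 z.

Lemma is_poly3_integrable F : is_poly3 F -> gauss3.-integrable setT (EFin \o F).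
Proof.
move=> [s Fs].
have h (m : R * (nat * (nat * nat))) : mean_is gauss3 (fun z : T3 => m.1 * mono3 m.2 z)
    (m.1 * (momn 0 m.2.1 * (momn 0 m.2.2.1 * momn 0 m.2.2.2))).
  apply: mean_isZ; apply: mean_is_ext (mean_is_mono3 _ _ _ (lexx 0)) => z.
  by rewrite powRr0 mul1r.
have [hi _] := mean_is_sum s h.
by apply: eq_integrable hi => // z _ /=; rewrite Fs.
Qed.

Lemma is_poly3_cst c : is_poly3 (fun=> c).
Proof. by exists [:: (c, (0, (0, 0)))%N] => z; rewrite big_seq1 /mono3/= !expr0 !mulr1. Qed.

Lemma is_poly3_c1 : is_poly3 (fun z => z.1).
Proof. by exists [:: (1, (1, (0, 0))%N)] => z; rewrite big_seq1 /mono3/= !expr0 !mulr1 mul1r. Qed.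
Lemma is_poly3_c2 : is_poly3 (fun z => z.2.1).
Proof. by exists [:: (1, (0, (1, 0))%N)] => z; rewrite big_seq1 /mono3/= !expr0 !mulr1 !mul1r. Qed.
Lemma is_poly3_c3 : is_poly3 (fun z => z.2.2).
Proof. by exists [:: (1, (0, (0, 1))%N)] => z; rewrite big_seq1 /mono3/= !expr0 !mul1r. Qed.

Lemma is_poly3D F G : is_poly3 F -> is_poly3 G -> is_poly3 (fun z => F z + G z).
Proof. by move=> [s Fs] [t Gt]; exists (s ++ t) => z; rewrite big_cat/= Fs Gt. Qed.

Lemma is_poly3M F G : is_poly3 F -> is_poly3 G -> is_poly3 (fun z => F z * G z).
Proof.
move=> [s Fs] [t Gt].
exists [seq (m.1 * n.1, (m.2.1 + n.2.1, (m.2.2.1 + n.2.2.1, m.2.2.2 + n.2.2.2))%N) | m <- s, n <- t] => z.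
rewrite Fs Gt big_allpairs_dep mulr_suml; apply: eq_bigr => m _.
rewrite mulr_sumr; apply: eq_bigr => n _; by rewrite /mono3/= !exprD; ring.
Qed.

Lemma is_poly3X F n : is_poly3 F -> is_poly3 (fun z => F z ^+ n).
Proof.
move=> Fp; elim: n => [|n ih]; first exact: is_poly3_cst.
by have [s hs] := is_poly3M Fp ih; exists s => z; rewrite exprS -hs.
Qed.

Lemma is_poly3_horner (p : {poly R}) F : is_poly3 F -> is_poly3 (fun z => p.[F z]).
Proof.
move=> Fp; elim/poly_ind: p => [|p c ih].
  by have [s hs] := is_poly3_cst 0; exists s => z; rewrite horner0.
have [s hs] := is_poly3D (is_poly3M ih Fp) (is_poly3_cst c); exists s => z.
by rewrite -hs !hornerE.
Qed.

Lemma is_poly3_sqn : is_poly3 (@sqn3 R).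
Proof.
by apply: is_poly3D; [apply: is_poly3D|]; apply: is_poly3X;
  [exact: is_poly3_c2|exact: is_poly3_c3|exact: is_poly3_c1].
Qed.

Lemma is_poly3_dens4 A B C : is_poly3 (dens4 A B C).
Proof.
apply: is_poly3D; [apply: is_poly3D|]; apply: is_poly3M; try exact: is_poly3_cst.
- by apply: is_poly3X; exact: is_poly3_sqn.
- by apply: is_poly3M; [exact: is_poly3_sqn|apply: is_poly3X; exact: is_poly3_c1].
- by apply: is_poly3X; exact: is_poly3_c1.
Qed.

Lemma dot3_sqr_le (x y : T3) : dot3 x y ^+ 2 <= sqn3 x * sqn3 y.
Proof.
case: x => [x1 [x2 x3]]; case: y => [y1 [y2 y3]]; rewrite /dot3 /sqn3/= -subr_ge0.
rewrite (_ : _ - _ = (x1 * y2 - x2 * y1) ^+ 2 + (x1 * y3 - x3 * y1) ^+ 2 + (x2 * y3 - x3 * y2) ^+ 2).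
  by rewrite !addr_ge0 ?sqr_ge0.
ring.
Qed.

Lemma powR_le_1Dsqr (q t : R) : 0 <= q <= 2 -> `|t| `^ q <= 1 + t ^+ 2.
Proof.
move=> /andP[q0 q2]; have [t1|t1] := leP `|t| 1.
  rewrite (@le_trans _ _ 1) ?lerDl ?sqr_ge0//.
  by have := @ge0_ler_powR _ q q0 `|t| 1; rewrite powR1; apply => //; rewrite nnegrE.
rewrite (@le_trans _ _ (`|t| `^ 2))//; first by rewrite ler_powR// ltW.
by rewrite powR_mulrn// real_normK ?num_real// lerDr.
Qed.

Lemma abs_dot3_le (q : R) (x y : T3) : 0 <= q <= 2 ->
  `|dot3 x y| `^ q <= (1 + sqn3 x) * (1 + sqn3 y).
Proof.
move=> q02; apply: le_trans (powR_le_1Dsqr _ q02) _.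
apply: (@le_trans _ _ (1 + sqn3 x * sqn3 y)); first by rewrite lerD2l dot3_sqr_le.
have := sqn3_ge0 x; have := sqn3_ge0 y; nra.
Qed.

Lemma measurable_dot3_prod d (Om : measurableType d) (f : Om -> T3) :
  measurable_fun setT f -> measurable_fun setT (fun z : T3 * Om => dot3 z.1 (f z.2)).
Proof.
move=> mf.
have mf2 : measurable_fun setT (fun z : T3 * Om => f z.2) := measurableT_comp mf measurable_snd.
have [m1 m2 m3] := And3 (@measurable_c1 R) (@measurable_c2 R) (@measurable_c3 R).
by apply: measurable_funD; [apply: measurable_funD|]; apply: measurable_funM;
 [exact: (measurableT_comp m1 measurable_fst)|exact: (measurableT_comp m1 mf2)
 |exact: (measurableT_comp m2 measurable_fst)|exact: (measurableT_comp m2 mf2)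
 |exact: (measurableT_comp m3 measurable_fst)|exact: (measurableT_comp m3 mf2)].
Qed.

Lemma integrable_mean d (Om : measurableType d) (m : {measure set Om -> \bar R}) (F : Om -> R) :
  m.-integrable setT (EFin \o F) -> mean_is m F (\int[m]_x F x).
Proof. by []. Qed.

(** Exchange of the two iterated integrals, for inner integrals known in closed
    form at every point. *)
Lemma fubini_mean d1 d2 (T1 : measurableType d1) (T2 : measurableType d2)
  (m1 : {sigma_finite_measure set T1 -> \bar R}) (m2 : {sigma_finite_measure set T2 -> \bar R})
  (F : T1 * T2 -> R) (G1 : T1 -> R) (G2 : T2 -> R) :
  (m1 \x m2)%E.-integrable setT (EFin \o F) ->
  (forall x, mean_is m2 (fun y => F (x, y)) (G1 x)) ->
  (forall y, mean_is m1 (fun x => F (x, y)) (G2 y)) ->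
  exists2 v, mean_is m1 G1 v & mean_is m2 G2 v.
Proof.
move=> Fi H1 H2; exists (\int[(m1 \x m2)%E]_z F z).
  have FE : fubini_F m2 (EFin \o F) = EFin \o G1.
    by apply/funext => x; exact: mean_is_integral.
  have Gi : m1.-integrable setT (EFin \o G1) by rewrite -FE; exact: integrable_fubini_F.
  split => //; rewrite /Rintegral; congr fine.
  by rewrite -(integral12_prod_meas1 Fi) FE.
have FE : fubini_G m1 (EFin \o F) = EFin \o G2.
  by apply/funext => x; exact: mean_is_integral.
have Gi : m2.-integrable setT (EFin \o G2).
  have mF : measurable_fun setT (EFin \o F) := measurable_int _ Fi.
  apply/integrableP; split; first by rewrite -FE; exact: (measurable_fubini_G Fi).
  have hoo := (integrable21ltyP m1 m2 mF).1 Fi; apply: le_lt_trans hoo.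
  apply: ge0_le_integral => //.
  - by apply: measurableT_comp => //; rewrite -FE; exact: (measurable_fubini_G Fi).
  - have mA : measurable_fun setT (abse \o (EFin \o F)) by exact: measurableT_comp.
    exact: (measurable_fun_fubini_tonelli_G _ mA (fun z => abse_ge0 _)).
  - move=> y _; rewrite -FE; apply: le_abse_integral => //.
    exact: measurableT_comp mF (measurable_pair2 y).
split => //; rewrite /Rintegral; congr fine.
by rewrite -(integral21_prod_meas1 Fi) FE.
Qed.

(** Multiply the two representations of V by He_2k(x3) and integrate over a
    Gaussian x.  By Fubini and [mean_is_hermite_dot3] each becomes the same
    nonzero constant times the integral of |.|^q lat^(2k), and on the side of m
    the integrand is nonnegative. *)
Lemma zonal_duality d (Om : measurableType d) (m : {sigma_finite_measure set Om -> \bar R})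
    (f : Om -> T3) (q A B C : R) (V : T3 -> R) k :
  0 < q <= 2 -> measurable_fun setT f ->
  (forall x, mean_is m (fun t => `|dot3 x (f t)| `^ q) (V x)) ->
  (forall x, mean_is gauss3 (fun y => `|dot3 x y| `^ q * dens4 A B C y) (V x)) ->
  wmoment q (hermite R k.*2) != 0 ->
  exists2 w, 0 <= w &
    mean_is gauss3 (fun y => nrm3 y `^ q * lat3 y ^+ k.*2 * dens4 A B C y) w.
Proof.
move=> /andP[q0 q2] mf fV gV; set n := k.*2; set L := wmoment q _ => L0.
have q02 : 0 <= q <= 2 by rewrite (ltW q0).
pose H (x : T3) := (hermite R n).[x.1].
have mH : measurable_fun setT H by apply: (measurableT_comp _ (@measurable_c1 R)); exact: measurable_poly.
have mD := @measurable_dens4 R A B C.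
have V0 x : 0 <= V x.
  by apply: (le_mean (mean_is0 m) (fV x)) => t; rewrite powR_ge0.
pose K2 (z : T3 * T3) := H z.1 * (`|dot3 z.1 z.2| `^ q * dens4 A B C z.2).
(* |<x, y>|^q is at most (1 + |x|^2) (1 + |y|^2), a product of polynomials. *)
have iK2 : (gauss3 \x gauss3)%E.-integrable setT (EFin \o K2).
  have p1 : is_poly3 (fun x => H x * (1 + sqn3 x)).
    apply: is_poly3M; first by apply: is_poly3_horner; exact: is_poly3_c1.
    by apply: is_poly3D; [exact: is_poly3_cst|exact: is_poly3_sqn].
  have p2 : is_poly3 (fun y => (1 + sqn3 y) * dens4 A B C y).
    apply: is_poly3M; last exact: is_poly3_dens4.
    by apply: is_poly3D; [exact: is_poly3_cst|exact: is_poly3_sqn].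
  have [hi _] := mean_isM (integrable_mean (is_poly3_integrable p1)) (integrable_mean (is_poly3_integrable p2)).
  apply: le_integrable hi => //.
    apply/measurable_EFinP; apply: measurable_funM; first exact: (measurableT_comp mH measurable_fst).
    apply: measurable_funM; last exact: (measurableT_comp mD measurable_snd).
    apply: (measurableT_comp (@measurable_abs_powR R q)).
    exact: (@measurable_dot3_prod _ _ id (@measurable_id _ _ _)).
  move=> [x y] _ /=; rewrite lee_fin !normrM (ger0_norm (powR_ge0 _ _)).
  have s1 (z : T3) : 0 <= 1 + sqn3 z by rewrite addr_ge0 ?sqn3_ge0.
  rewrite (ger0_norm (s1 x)) (ger0_norm (s1 y)).
  rewrite -mulrA ler_wpM2l// mulrA ler_wpM2r//; exact: abs_dot3_le.
have K2x x : mean_is gauss3 (fun y => K2 (x, y)) (H x * V x) by exact: (mean_isZ (H x) (gV x)).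
have K2y y : mean_is gauss3 (fun x => K2 (x, y)) (dens4 A B C y * (nrm3 y `^ q * lat3 y ^+ n * L)).
  apply: mean_is_ext (mean_isZ (dens4 A B C y) (mean_is_hermite_dot3 n y q0)) => x.
  by rewrite /K2/= [LHS]mulrC -mulrA mulrCA mulrA mulrAC -mulrA.
have [v Hv1 Hv2] := fubini_mean iK2 K2x K2y.
pose K1 (z : T3 * Om) := H z.1 * `|dot3 z.1 (f z.2)| `^ q.
(* There is no pointwise bound on f; but |K1| integrates over t to |H| V, whose
   integrability comes from the Gaussian representation. *)
have iK1 : (gauss3 \x m)%E.-integrable setT (EFin \o K1).
  apply/integrable12ltyP.
    apply/measurable_EFinP; apply: measurable_funM; first exact: (measurableT_comp mH measurable_fst).
    by apply: (measurableT_comp (@measurable_abs_powR R q)); exact: measurable_dot3_prod.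
  have [/integrableP[_ hv] _] := Hv1; apply: le_lt_trans hv.
  rewrite le_eqVlt; apply/orP; left; apply/eqP; apply: eq_integral => x _ /=.
  rewrite normrM (ger0_norm (V0 x)).
  rewrite -(mean_is_integral (mean_isZ `|H x| (fV x))).
  by apply: eq_integral => t _; rewrite /K1/= normrM (ger0_norm (powR_ge0 _ _)).
have K1x x : mean_is m (fun t => K1 (x, t)) (H x * V x) by exact: (mean_isZ (H x) (fV x)).
have K1t t : mean_is gauss3 (fun x => K1 (x, t)) (nrm3 (f t) `^ q * lat3 (f t) ^+ n * L).
  by apply: mean_is_ext (mean_is_hermite_dot3 n (f t) q0) => x; rewrite /K1/= mulrC.
have [v' Hv1' Hv2'] := fubini_mean iK1 K1x K1t.
have vv' := mean_is_unique Hv1 Hv1'.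
exists (L^-1 * v).
  rewrite vv'; apply: (le_mean (mean_is0 m) (mean_isZ L^-1 Hv2')) => t.
  rewrite mulrCA mulVf// mulr1 mulr_ge0 ?powR_ge0//.
  by rewrite exprn_even_ge0// /n odd_double.
apply: mean_is_ext (mean_isZ L^-1 Hv2) => y.
by rewrite mulrCA [L^-1 * _]mulrC mulfK// mulrC.
Qed.
End duality.

(** * Nonnegativity at the pole *)
Section pole.
Set Implicit Arguments.
Unset Strict Implicit.
Context (R : realType).
Local Notation T := (measurableTypeR R).
Local Notation T3 := (T * (T * T))%type.
Local Notation g := (gauss1 R).
Local Notation gauss3 := (gauss3 R).

Lemma gauss1_itv_gt0 (a b : R) : -1 <= a -> a < b -> b <= 1 ->
  (0 < g `[a, b]%classic)%E.
Proof.
move=> a1 ab b1; pose c : R := normal_peak 1 * expR (- 2^-1).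
have c0 : 0 < c by rewrite mulr_gt0 ?expR_gt0// normal_peak_gt0// oner_neq0.
apply: (@lt_le_trans _ _ (\int[lebesgue_measure]_(x in (`[a, b]%classic : set T)) c%:E)%E).
  rewrite integral_cst//=; rewrite lebesgue_measure_itv/= lte_fin ab -EFinD -EFinM lte_fin.
  by rewrite mulr_gt0// subr_gt0.
rewrite /gauss1/= /normal_prob; apply: ge0_le_integral => //.
- by move=> x _; rewrite lee_fin ltW.
- by apply/measurable_EFinP/measurable_funTS; exact: measurable_normal_pdf.
move=> x; rewrite /= in_itv/= => /andP[ax xb]; rewrite lee_fin normal_pdf01.
rewrite ler_wpM2l ?normal_peak_ge0// ler_expR mulNr lerN2 ler_pdivrMr// mulVf//.
have {}ax := le_trans a1 ax; have {}xb := le_trans xb b1.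
by move: (x : R) ax xb => z; nra.
Qed.

(** The size of the integrand once the powers of the latitude are taken out. *)
Definition weight (q : R) (y : T3) : R := nrm3 y `^ q * sqn3 y ^+ 2.

Lemma measurable_nrm3 : measurable_fun setT (@nrm3 R).
Proof. exact: (measurableT_comp (continuous_measurable_fun (@sqrt_continuous R)) (@measurable_sqn3 R)). Qed.

Lemma measurable_weight q : measurable_fun setT (weight q).
Proof.
apply: measurable_funM; last by apply: measurable_funX; exact: measurable_sqn3.
exact: (measurableT_comp (measurable_powR q) measurable_nrm3).
Qed.

Lemma weight_ge0 q y : 0 <= weight q y.
Proof. by rewrite mulr_ge0 ?powR_ge0// exprn_ge0// sqn3_ge0. Qed.

Lemma integrable_weight q : 0 <= q <= 2 -> gauss3.-integrable setT (EFin \o weight q).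
Proof.
move=> q02.
have p : is_poly3 (fun y => (1 + @sqn3 R y) * sqn3 y ^+ 2).
  apply: is_poly3M; last by apply: is_poly3X; exact: is_poly3_sqn.
  by apply: is_poly3D; [exact: is_poly3_cst|exact: is_poly3_sqn].
apply: le_integrable (is_poly3_integrable p) => //.
  by apply/measurable_EFinP; exact: measurable_weight.
move=> y _ /=; rewrite lee_fin.
have le_wp : weight q y <= (1 + sqn3 y) * sqn3 y ^+ 2.
  rewrite ler_wpM2r ?exprn_ge0 ?sqn3_ge0// -sqr_nrm3.
  by have := powR_le_1Dsqr (nrm3 y) q02; rewrite ger0_norm ?nrm3_ge0.
by rewrite !ger0_norm// ?(le_trans _ le_wp)// weight_ge0.
Qed.

(** The double cone lat^2 >= r about the polar axis. *)
Definition cap (r : R) : set T3 := [set y | r * sqn3 y <= y.1 ^+ 2].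

Lemma measurable_cap r : measurable (cap r).
Proof.
have m1 : measurable_fun setT (fun y : T3 => r * sqn3 y).
  by apply: measurable_funM => //; exact: measurable_sqn3.
have m2 : measurable_fun setT (fun y : T3 => y.1 ^+ 2 : R).
  by apply: measurable_funX; exact: measurable_c1.
have := measurable_fun_ler m1 m2 measurableT (Y := [set true]) I.
by rewrite setTI; congr (measurable _).
Qed.

(** The cone contains a box [1/2, 1] x [-e, e]^2 of positive Gaussian measure
    on which the weight is bounded below. *)
Lemma cap_weight q r : 0 <= q <= 2 -> r < 1 ->
  exists2 c, 0 < c & mean_is gauss3 (fun y => weight q y * \1_(cap r) y) c.
Proof.
move=> q02 r1; have [/andP[q0 _] iw] := (q02, integrable_weight q02).
have mF : measurable_fun setT (fun y => weight q y * \1_(cap r) y).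
  by apply: measurable_funM; [exact: measurable_weight|apply: measurable_indic; exact: measurable_cap].
have iF : gauss3.-integrable setT (EFin \o (fun y => weight q y * \1_(cap r) y)).
  apply: le_integrable iw => //; first exact/measurable_EFinP.
  move=> y _ /=; rewrite lee_fin normrM ler_piMr//.
  by rewrite indicE; case: (_ \in _); rewrite ?normr1 ?normr0.
exists (\int[gauss3]_y (weight q y * \1_(cap r) y)); last exact: integrable_mean.
(* On the box y1^2 + y2^2 <= 2 e^2 <= e <= (1 - r) / 8 while y3^2 >= 1/4. *)
pose e : R := Num.min (1 / 2) ((1 - r) / 8).
have e0 : 0 < e by rewrite lt_min divr_gt0// divr_gt0// subr_gt0.
have [e2 er] : e <= 1 / 2 /\ e <= (1 - r) / 8 by split; rewrite ge_min lexx ?orbT.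
pose Bx := (`[1 / 2 : R, 1]%classic `*` (`[- e, e]%classic `*` `[- e, e]%classic)) : set T3.
have mBx : measurable Bx by apply: measurableX => //; exact: measurableX.
pose d : R := (1 / 2) `^ q * (1 / 4) ^+ 2.
have d0 : 0 < d by rewrite mulr_gt0 ?powR_gt0 ?exprn_gt0// divr_gt0.
have Bx0 : (0 < gauss3 Bx)%E.
  rewrite /gauss3/= [X in (0 < X)%E](@product_measure1E _ _ T (T * T)%type R g (gauss2 R))//; last exact: measurableX.
  rewrite /gauss2/= [X in (0 < _ * X)%E](@product_measure1E _ _ T T R g g)//.
  have h1 : (0 < g `[(1 / 2)%R, 1%R]%classic)%E by apply: gauss1_itv_gt0; lra.
  have h2 : (0 < g `[(- e)%R, e]%classic)%E by apply: gauss1_itv_gt0; lra.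
  by rewrite !mule_gt0.
rewrite -lte_fin -(mean_is_integral (integrable_mean iF)).
apply: (@lt_le_trans _ _ (\int[gauss3]_y (d * \1_Bx y)%:E)%E).
  rewrite (_ : (\int[gauss3]_y (d * \1_Bx y)%:E)%E = (d%:E * gauss3 Bx)%E) ?mule_gt0//.
  rewrite -[in RHS](setIT Bx) -(integral_indic gauss3 measurableT mBx).
  have mi : measurable_fun setT (fun y : T3 => (\1_Bx y : R)%:E).
    exact/measurable_EFinP/measurable_indic.
  have i0 (y : T3) : setT y -> (0 <= (\1_Bx y : R)%:E)%E by move=> _; rewrite lee_fin.
  have d0' : (0 <= d%:E)%E by rewrite lee_fin ltW.
  exact: (ge0_integralZl gauss3 measurableT mi i0 d0').
apply: ge0_le_integral => //.
- by move=> y _; rewrite lee_fin mulr_ge0 ?indicE// ltW.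
- by apply/measurable_EFinP/measurable_funM => //; exact: measurable_indic.
- exact/measurable_EFinP.
move=> [y [y2 y3]] _; rewrite lee_fin indicE.
have [|_] := boolP (_ \in Bx); last by rewrite mulr0 mulr_ge0 ?weight_ge0// indicE.
rewrite inE /Bx/= !in_itv/= => -[/andP[h1 h2] [/andP[h3 h4] /andP[h5 h6]]].
have y2e : y2 ^+ 2 <= e by nra.
have y3e : y3 ^+ 2 <= e by nra.
have hy : 1 / 4 <= y ^+ 2 by nra.
have hs : 1 / 4 <= sqn3 (y, (y2, y3)).
  by rewrite /sqn3/= (le_trans hy)// lerDr addr_ge0 ?sqr_ge0.
have -> : \1_(cap r) (y, (y2, y3)) = 1 :> R.
  rewrite indicE mem_set//= /cap/= /sqn3/=.
  have [r0|r0] := leP r 0.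
    by apply: (@le_trans _ _ 0); rewrite ?sqr_ge0// mulr_le0_ge0// !addr_ge0 ?sqr_ge0.
  have : r * (y2 ^+ 2 + y3 ^+ 2) <= (1 - r) * (1 / 4) by nra.
  nra.
rewrite !mulr1 /weight ler_pM ?powR_ge0 ?exprn_ge0//.
  rewrite ge0_ler_powR ?nnegrE ?nrm3_ge0 ?divr_ge0//.
  rewrite -(@ler_pXn2r _ 2) ?nnegrE ?nrm3_ge0 ?divr_ge0// sqr_nrm3; apply: le_trans hs; lra.
by rewrite lerXn2r ?nnegrE ?divr_ge0 ?sqn3_ge0.
Qed.

Lemma sqn3_lat (y : T3) : nrm3 y != 0 -> y.1 ^+ 2 = lat3 y ^+ 2 * sqn3 y.
Proof. by move=> y0; rewrite /lat3 expr_div_n -sqr_nrm3 divfK// sqrf_eq0. Qed.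

(** Bernoulli: (s / r)^k >= 1 + k (s / r - 1) is unbounded. *)
Lemma geometric_gap (r s a b : R) : 0 < r -> r < s -> 0 < b ->
  (forall k, b * s ^+ k <= a * r ^+ k) -> False.
Proof.
move=> r0 rs b0 H; pose t : R := s / r; pose e : R := t - 1.
have e0 : 0 < e by rewrite subr_gt0 ltr_pdivlMr// mul1r.
have bern k : 1 + k%:R * e <= t ^+ k.
  elim: k => [|k ih]; first by rewrite mul0r addr0.
  have t1 : t = 1 + e by rewrite /e; ring.
  have ke : 0 <= k%:R * e by rewrite mulr_ge0 ?ler0n ?(ltW e0).
  have t0 : 0 <= t by rewrite t1 addr_ge0// ltW.
  rewrite exprS -natr1; apply: (@le_trans _ _ (t * (1 + k%:R * e))); last by rewrite ler_wpM2l.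
  rewrite t1 [leRHS](_ : _ = 1 + (k%:R + 1) * e + k%:R * e * e); last by ring.
  by rewrite lerDl mulr_ge0// ltW.
have bt k : b * t ^+ k <= a.
  by rewrite -(@ler_pM2r _ (r ^+ k)) ?exprn_gt0// -mulrA -exprMn /t divfK ?gt_eqF// H.
pose k := (Num.truncn (a / (b * e))).+1.
have be0 : 0 < b * e by rewrite mulr_gt0.
have ak : a < k%:R * (b * e).
  by rewrite -ltr_pdivrMr// truncnS_gt.
have := bt k; rewrite leNgt => /negP; apply.
apply: (lt_le_trans ak); apply: (@le_trans _ _ (b * (1 + k%:R * e))); last by rewrite ler_wpM2l// ltW.
by rewrite mulrCA ler_wpM2l ?(ltW b0)// lerDr.
Qed.

(** If the value at the pole were negative, the density would be at most
    - d |y|^4 on a cone lat^2 >= r.  Off this cone lat^(2k) <= r^k, while on the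
    smaller cone lat^2 >= s > r the negative part contributes at least a
    multiple of s^k; for large k the integral would be negative. *)
Lemma pole_ge0 (q A B C : R) : 0 <= q <= 2 ->
  (forall k, exists2 w, 0 <= w &
    mean_is gauss3 (fun y => nrm3 y `^ q * lat3 y ^+ k.*2 * dens4 A B C y) w) ->
  0 <= A + B + C.
Proof.
move=> q02 H; rewrite leNgt; apply/negP => S0.
(* L bounds the variation in lat^2 of A + B lat^2 + C lat^4, so that moving by
   d / L from the pole changes it by at most half of its value there. *)
pose d : R := - (A + B + C) / 2; have d0 : 0 < d by rewrite divr_gt0// oppr_gt0.
pose L : R := `|B| + 2 * `|C| + 1; have L0 : 0 < L by rewrite ltr_wpDl// addr_ge0// mulr_ge0.
pose h : R := Num.min (d / L) (1 / 2).
have h0 : 0 < h by rewrite lt_min; apply/andP; split; exact: divr_gt0.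
have [hd h2] : h <= d / L /\ h <= 1 / 2 by split; rewrite ge_min lexx ?orbT.
have hL : h * L <= d by rewrite -ler_pdivlMr.
pose r : R := 1 - h; pose s : R := (1 + r) / 2.
have r0 : 0 < r by rewrite /r; lra.
have rs : r < s by rewrite /s /r; lra.
have s1 : s < 1 by rewrite /s /r; lra.
pose M : R := `|A| + `|B| + `|C|.
have [c c0 Hc] := cap_weight q02 s1.
have Ha := integrable_mean (integrable_weight q02); set a := (X in mean_is _ _ X) in Ha.
apply: (@geometric_gap r s (M * a) (d * c)) => //; first exact: mulr_gt0.
move=> k; have [w w0 Hw] := H k.
have Hm := mean_isD (mean_isZ (M * r ^+ k) Ha) (mean_isZ (- (d * s ^+ k)) Hc).
suff /(le_trans w0) : w <= M * r ^+ k * a + - (d * s ^+ k) * c.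
  by rewrite mulNr subr_ge0 mulrAC [in leRHS]mulrAC.
apply: (le_mean Hw Hm) => y {Hw Hm Hc Ha H}.
have w0' := weight_ge0 q y.
have [y0|y0] := eqVneq (nrm3 y) 0.
  have -> : weight q y = 0 by rewrite /weight -sqr_nrm3 y0; ring.
  have -> : dens4 A B C y = 0 by rewrite (nrm3_eq0 y0) /dens4 /sqn3/=; ring.
  by rewrite mul0r !mulr0 addr0.
set u : R := lat3 y ^+ 2.
have u1 : u <= 1 by exact: lat3_sqr_le1.
have u0 : 0 <= u by exact: sqr_ge0.
pose P : R := A + B * u + C * u ^+ 2.
have -> : nrm3 y `^ q * lat3 y ^+ k.*2 * dens4 A B C y = weight q y * (u ^+ k * P).
  rewrite /dens4 (_ : y.1 ^+ 4 = (y.1 ^+ 2) ^+ 2); last by rewrite -exprM.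
  rewrite (sqn3_lat y0) -mul2n exprM -/u /weight /P; ring.
have -> : (\1_(cap s) : T3 -> R) y = (s <= u)%R%:R.
  rewrite indicE /cap; congr (nat_of_bool _)%:R.
  have sq0 : 0 < sqn3 y by rewrite -sqr_nrm3 exprn_even_gt0.
  apply/idP/idP; rewrite inE/= (sqn3_lat y0) ler_pM2r//.
have ur (x : R) n : 0 <= x -> 0 <= x ^+ n by move=> x0; exact: exprn_ge0.
have P_M : P <= M.
  rewrite /P /M; apply: lerD; first apply: lerD.
  - exact: ler_norm.
  - by apply: le_trans (ler_norm _) _; rewrite normrM (ger0_norm u0) ler_piMr.
  - by apply: le_trans (ler_norm _) _; rewrite normrM normrX (ger0_norm u0) ler_piMr// expr_le1.
have M0 : 0 <= M by rewrite !addr_ge0.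
have [ru|ur'] := leP r u; last first.
  rewrite (_ : (s <= u) = false); last by apply/negbTE; rewrite -ltNge (lt_trans ur').
  rewrite mulr0 mulr0 addr0 [leRHS]mulrC ler_wpM2l//.
  apply: (@le_trans _ _ (u ^+ k * M)); first by rewrite ler_wpM2l// ur.
  by rewrite mulrC ler_wpM2l// lerXn2r ?nnegrE ?(ltW r0) ?(ltW ur').
have Pd : P <= - d.
  have : P - (A + B + C) <= (1 - u) * L.
    rewrite (_ : _ - _ = (1 - u) * (- B - C * (1 + u))); last by rewrite /P; ring.
    rewrite ler_wpM2l ?subr_ge0// /L.
    have := ler_norm (- B); have := ler_norm (- C); rewrite !normrN => hC hB.
    have : - C * (1 + u) <= `|C| * 2.
      apply: (@le_trans _ _ (`|C| * (1 + u))); first by rewrite ler_wpM2r// addr_ge0.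
      by rewrite ler_wpM2l//; lra.
    by rewrite mulNr => hCu; lra.
  have : (1 - u) * L <= h * L by rewrite ler_wpM2r ?(ltW L0)//; rewrite /r in ru; lra.
  rewrite /d in hL *; lra.
have le1 : u ^+ k * P <= - (d * s ^+ k) * (s <= u)%R%:R.
  have [su|_] := leP s u.
    rewrite mulr1; apply: (@le_trans _ _ (u ^+ k * - d)); first by rewrite ler_wpM2l// ur.
    have s0 : 0 <= s by rewrite ltW// (lt_trans r0).
    by rewrite mulrN lerN2 [d * _]mulrC ler_wpM2r ?(ltW d0)// lerXn2r ?nnegrE.
  have P0 : P <= 0 by apply: le_trans Pd _; rewrite oppr_le0 ltW.
  by rewrite mulr0 mulr_ge0_le0// ur.
apply: (@le_trans _ _ (weight q y * (- (d * s ^+ k) * (s <= u)%R%:R))); first by rewrite ler_wpM2l.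
by rewrite mulrCA lerDr mulr_ge0// mulr_ge0// ur// ltW.
Qed.
End pole.

(** * Every law on space is the law of a function on the unit interval *)
Lemma measure_eq_of_rays (R : realType) (m1 m2 : {measure set (measurableTypeR R) -> \bar R}) :
  (m1 setT < +oo)%E -> (forall r : R, m1 `]r, +oo[%classic = m2 `]r, +oo[%classic) ->
  forall A, measurable A -> m1 A = m2 A.
Proof.
move=> m1T m12 A mA.
pose G : set (set (measurableTypeR R)) := [set B | exists x : R, B = `]x, +oo[%classic].
pose g (n : nat) : set (measurableTypeR R) := `](- n%:R : R), +oo[%classic.
apply: (@measure_unique _ R (measurableTypeR R) G g) => //.
- exact: RGenOInfty.measurableE.
- move=> _ _ [x ->] [y ->]; exists (Num.max x y).
  by apply/seteqP; split => z /=; rewrite !in_itv/= !andbT gt_max => /andP.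
- by move=> n; exists (- n%:R).
- apply/seteqP; split => // x _; exists (Num.truncn (`|x|)).+1 => //.
  rewrite /g/= in_itv/= andbT ltrNl; apply: le_lt_trans (truncnS_gt _).
  by rewrite -normrN; exact: (@ler_norm R (- (x : R))).
- by move=> _ [x ->]; exact: m12.
- move=> n; apply: le_lt_trans m1T; apply: le_measure => //; rewrite inE //.
  exact: measurable_itv.
Qed.

Section quantile.
Set Implicit Arguments.
Unset Strict Implicit.
Context (R : realType) (P : probability (measurableTypeR R) R).
Local Notation T := (measurableTypeR R).

Let idT : T -> R := idfun.
#[local] HB.instance Definition _ :=
  @isMeasurableFun.Build _ _ _ _ idT (@measurable_id _ _ setT).

Definition distr_fun (r : R) : R := fine (P `]-oo, r]%classic).

Lemma distr_funE r : (distr_fun r)%:E = P `]-oo, r]%classic.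
Proof. by rewrite /distr_fun fineK// fin_num_measure//; exact: measurable_itv. Qed.

Lemma distr_fun_nd : {homo distr_fun : x y / x <= y}.
Proof.
move=> x y xy; rewrite -lee_fin !distr_funE.
exact: (@cdf_nondecreasing _ _ _ P (idT : {RV P >-> R}) x y xy).
Qed.

Lemma distr_fun_rc a : distr_fun x @[x --> a^'+] --> distr_fun a.
Proof.
apply: fine_cvg; rewrite fineK; first exact: (@cdf_right_continuous _ _ _ P (idT : {RV P >-> R}) a).
by rewrite fin_num_measure//; exact: measurable_itv.
Qed.

Lemma distr_fun_pinfty : distr_fun x @[x --> +oo] --> (1 : R).
Proof. exact: fine_cvg (@cvg_cdfy1 _ _ _ P (idT : {RV P >-> R})). Qed.

Lemma distr_fun_ninfty : distr_fun x @[x --> -oo] --> (0 : R).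
Proof. exact: fine_cvg (@cvg_cdfNy0 _ _ _ P (idT : {RV P >-> R})). Qed.

Lemma distr_fun_ge0 r : 0 <= distr_fun r.
Proof. by rewrite fine_ge0. Qed.

Lemma distr_fun_le1 r : distr_fun r <= 1.
Proof. by rewrite -lee_fin distr_funE probability_le1//; exact: measurable_itv. Qed.

(** The value 0 outside the open unit interval is arbitrary. *)
Definition quantile (t : T) : T := if 0 < t < 1 then inf [set x | t <= distr_fun x] else 0.

(** The infimum is attained, by right continuity of the distribution function. *)
Lemma quantile_le (t r : R) : 0 < t < 1 -> (quantile t <= r) = (t <= distr_fun r).
Proof.
move=> t01; rewrite /quantile t01; case/andP: t01 => t0 t1.
set A := [set x | t <= distr_fun x].
have hl : has_lbound A.
  have : \forall x \near -oo, distr_fun x < t by exact: cvgr_lt distr_fun_ninfty t t0.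
  case=> M [Mr HM]; exists (M - 1) => x Ax; rewrite leNgt; apply/negP => xM.
  have xM' : x < M by apply: lt_trans xM _; rewrite ltrBlDr ltrDl.
  by have := HM x xM'; rewrite ltNge Ax.
have hn : A !=set0.
  have : \forall x \near +oo, t < distr_fun x by exact: cvgr_gt distr_fun_pinfty t t1.
  case=> M [Mr HM]; exists (M + 1); apply/ltW/HM; by rewrite ltrDl.
have hA : has_inf A by split.
apply/idP/idP => [Qr|]; last by move=> h; apply: ge_inf.
have /cvg_lim <- // := @distr_fun_rc r.
apply: limr_ge; first by apply: cvgP (@distr_fun_rc r).
near=> x.
have rx : r < x by near: x; exact: nbhs_right_gt.
have [y Ay yx] := inf_adherent (ltac:(rewrite subr_gt0; exact: rx) : 0 < x - r) hA.
apply: le_trans Ay _; apply: distr_fun_nd; apply: ltW; apply: lt_le_trans yx _.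
by rewrite -lerBrDr opprB addrC subrK.
Unshelve. all: by end_near. Qed.

End quantile.

Section quantile_law.
Set Implicit Arguments.
Unset Strict Implicit.
Context (R : realType) (P : probability (measurableTypeR R) R).
Local Notation T := (measurableTypeR R).

Lemma measurable_quantile : measurable_fun setT (quantile P : T -> T).
Proof.
apply: (measurability _ (RGenOInfty.measurableE R)).
move=> _ [_ [r ->] <-]; rewrite setTI.
rewrite (_ : _ @^-1` _ = ((`]0, 1[ : set T) `&` `]distr_fun P r, +oo[) `|`
   (~` `]0, 1[ `&` (if 0 > r then setT else set0))); last first.
  apply/seteqP; split => t /=.
    rewrite !in_itv/= !andbT => h; case: (boolP (0 < t < 1)) => t01.
      by left; split => //; rewrite ltNge -(@quantile_le R P t r t01) -ltNge.
    by right; split => //; move: h; rewrite /quantile (negbTE t01) => ->.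
  rewrite !in_itv/= !andbT => -[[t01]|[/negP t01]].
    by rewrite !ltNge (@quantile_le R P t r t01).
  by rewrite /quantile (negbTE t01); case: ifP.
apply: measurableU; apply: measurableI; try exact: measurable_itv.
- by apply: measurableC; exact: measurable_itv.
- by case: ifP.
Qed.

Lemma lebesgue01_open (B : set T) : measurable B ->
  lebesgue01 R B = lebesgue_measure (B `&` `]0, 1[).
Proof.
move=> mB; rewrite /lebesgue01/= /mrestr.
have mo : measurable (`]0, 1[%classic : set T) by exact: measurable_itv.
have mc : measurable (`[0, 1]%classic : set T) by exact: measurable_itv.
apply/eqP; rewrite eq_le; apply/andP; split; last first.
  apply: le_measure; rewrite ?inE; try exact: measurableI.
  by apply: setIS => x /=; rewrite !in_itv/= => /andP[? ?]; rewrite !ltW.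
have m0 (a : R) : measurable ([set a] : set T) by exact: measurable_set1.
apply: (@le_trans _ _ (lebesgue_measure ((B `&` `]0, 1[) `|` ([set 0] `|` [set 1] : set T)))).
  apply: le_measure; rewrite ?inE.
  - exact: measurableI.
  - by apply: measurableU; [exact: measurableI|exact: measurableU].
  - move=> x [Bx] /=; rewrite !in_itv/= => /andP[x0 x1].
    have [->|x0'] := eqVneq x 0; first by right; left.
    have [->|x1'] := eqVneq x 1; first by right; right.
    by left; split => //; rewrite !lt_neqAle x0 x1 x1' eq_sym x0'.
apply: (le_trans (measureU2 _ _ _)).
- exact: measurableI.
- exact: measurableU.
rewrite -[leRHS]adde0; apply: leeD => //.
apply: (le_trans (measureU2 _ _ _)) => //.
have s0 (a : R) : lebesgue_measure ([set a] : set T) = 0%E by exact: lebesgue_measure_set1.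
by have -> // : (lebesgue_measure ([set 0%R] : set T) + lebesgue_measure ([set 1%R] : set T) = 0)%E by rewrite !s0 adde0.
Qed.

Lemma quantile_law (A : set T) : measurable A ->
  lebesgue01 R (quantile P @^-1` A) = P A.
Proof.
move=> mA.
pose m1 : {measure set T -> \bar R} := P.
pose m2 := (pushforward (lebesgue01 R) (quantile P : T -> T) : {measure set T -> \bar R}).
apply/esym; apply: (@measure_eq_of_rays R m1 (m2 measurable_quantile)) => //.
  by have -> : m1 setT = 1%E by [exact: (probability_setT P)]; exact: ltry.
move=> r; change (P `]r, +oo[%classic = lebesgue01 R (quantile P @^-1` `]r, +oo[%classic)).
rewrite lebesgue01_open; last first.
  by rewrite -[X in measurable X]setTI; apply: measurable_quantile => //; exact: measurable_itv.
rewrite (_ : _ `&` _ = `]distr_fun P r, 1[%classic); last first.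
  apply/seteqP; split => t /=; rewrite !in_itv/= !andbT.
    by move=> [h t01]; rewrite ltNge -(@quantile_le R P t r t01) -ltNge h/=; case/andP: t01.
  move=> /andP[h t1].
  have t01 : 0 < t < 1 by rewrite t1 (le_lt_trans (distr_fun_ge0 P r) h).
  by split => //; rewrite ltNge (@quantile_le R P t r t01) -ltNge.
rewrite lebesgue_measure_itv/= lte_fin -setCitvl probability_setC; last exact: measurable_itv.
rewrite -distr_funE -EFinD.
case: ltP => // h; congr EFin; apply/eqP; rewrite subr_eq0 eq_le h.
exact: distr_fun_le1.
Qed.

End quantile_law.

(** * Coding sequences of bits by reals *)
Section ternary_digits.
Set Implicit Arguments.
Unset Strict Implicit.
Context (R : realType).
Local Notation T := (measurableTypeR R).

(** Truncation of the sum of 2 b_k / 3^(k+1).  Base 3 with the digits 0 and 2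
    makes the expansion unique, unlike base 2. *)
Fixpoint cantor_partial (n : nat) (b : nat -> bool) : R :=
  if n is m.+1 then (2 * (b 0%N)%:R + cantor_partial m (fun k => b k.+1)) / 3 else 0.

Lemma cantor_partial_itv n b : 0 <= cantor_partial n b <= 1.
Proof.
elim: n b => [|n IH] b /=; first by rewrite lexx ler01.
have /andP[h1 h2] := IH (fun k => b k.+1).
by apply/andP; split; case: (b 0%N) => /=; lra.
Qed.

Lemma cantor_partial_nd b : nondecreasing_seq (cantor_partial ^~ b).
Proof.
apply/nondecreasing_seqP => n; elim: n b => [|n IH] b.
  by have /andP[] := cantor_partial_itv 1 b.
by have := IH (fun k => b k.+1); rewrite /=; case: (b 0%N) => /=; lra.
Qed.

Definition cantor_sum (b : nat -> bool) : R := limn (cantor_partial ^~ b).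

Lemma cvg_cantor_sum b : cantor_partial ^~ b @ \oo --> cantor_sum b.
Proof.
apply: nondecreasing_is_cvgn; first exact: cantor_partial_nd.
by exists 1 => _ [n _ <-]; have /andP[] := cantor_partial_itv n b.
Qed.

Lemma cantor_sum_itv b : 0 <= cantor_sum b <= 1.
Proof.
by apply/andP; split; [apply: limr_ge|apply: limr_le]; try exact: cvg_cantor_sum;
  near=> n; have /andP[] := cantor_partial_itv n b.
Unshelve. all: by end_near. Qed.

Lemma cantor_sum_rec b : cantor_sum b = (2 * (b 0%N)%:R + cantor_sum (fun k => b k.+1)) / 3.
Proof.
have h : (fun n => cantor_partial n.+1 b) @ \oo --> cantor_sum b.
  by have := @cvg_cantor_sum b; rewrite -cvg_shiftS.
apply: (cvg_unique _ h) => //.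
apply: cvgM; last exact: cvg_cst.
by apply: cvgD; [exact: cvg_cst|exact: cvg_cantor_sum].
Qed.

(** Deletes the first ternary digit of a point of the Cantor set; 1/2 lies in
    the removed middle third, so it separates the digits 0 and 2. *)
Definition ternary_shift (s : R) : R := if 1 / 2 < s then 3 * s - 2 else 3 * s.

Definition digit (k : nat) (s : R) : bool := 1 / 2 < iter k ternary_shift s.

Lemma iter_ternary_shift k b : iter k ternary_shift (cantor_sum b) = cantor_sum (fun i => b (k + i)%N).
Proof.
elim: k b => [|k IH] b //.
rewrite iterSr /ternary_shift.
have /andP[h1 h2] := @cantor_sum_itv (fun k => b k.+1).
rewrite (_ : (if _ then _ else _) = cantor_sum (fun k => b k.+1)) ?IH//.
by rewrite (cantor_sum_rec b); case: (b 0%N) => /=; case: ltP => ?; lra.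
Qed.

Lemma digit_cantor_sum k b : digit k (cantor_sum b) = b k.
Proof.
rewrite /digit iter_ternary_shift cantor_sum_rec addn0.
have /andP[h1 h2] := @cantor_sum_itv (fun i => b (k + i.+1)%N).
by case: (b k) => /=; case: ltP => ? //; lra.
Qed.

Lemma measurable_digit k : measurable_fun setT (digit k : T -> bool).
Proof.
have m3 : measurable_fun setT (fun s : T => 3 * (s : R)).
  by apply: measurable_funM; [exact: measurable_cst|exact: measurable_id].
have ms : measurable_fun setT (ternary_shift : T -> T).
  apply: measurable_fun_if => //.
  - by apply: measurable_fun_ltr; [exact: measurable_cst|exact: measurable_id].
  - apply: measurable_funTS; apply: measurable_funB; [exact: m3|exact: measurable_cst].
have mi n : measurable_fun setT (iter n ternary_shift : T -> T).
  elim: n => [|n IH]; first exact: measurable_id.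
  exact: measurableT_comp ms IH.
by apply: measurable_fun_ltr; [exact: measurable_cst|exact: mi].
Qed.

Lemma measurable_cantor_sum d (S : measurableType d) (b : nat -> S -> bool) :
  (forall k, measurable_fun setT (b k)) ->
  measurable_fun setT (fun y => cantor_sum (fun k => b k y) : T).
Proof.
move=> mb; apply: (@measurable_fun_cvg _ _ _ _ (fun n y => cantor_partial n (fun k => b k y))).
  move=> n; elim: n b mb => [|n IH] b mb; first exact: measurable_cst.
  have mb0 : measurable_fun setT (fun y => (b 0%N y)%:R : R).
    rewrite (_ : (fun x => _) = (fun y => if b 0%N y then 1 else 0)); last first.
      by apply/funext => y; case: (b 0%N y).
    by apply: measurable_fun_ifT; [exact: mb|exact: measurable_cst|exact: measurable_cst].
  have mS : measurable_fun setT (fun y => cantor_partial n (fun k => b k.+1 y)).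
    by apply: (IH (fun k => b k.+1)) => k; exact: mb.
  have m2 : measurable_fun setT (fun y => 2 * (b 0%N y)%:R + cantor_partial n (fun k => b k.+1 y)).
    by apply: measurable_funD mS; apply: measurable_funM mb0; exact: measurable_cst.
  have m3 : measurable_fun setT (fun y => (2 * (b 0%N y)%:R + cantor_partial n (fun k => b k.+1 y)) / 3).
    by apply: measurable_funM m2 _; exact: measurable_cst.
  exact: m3.
by move=> y _; exact: cvg_cantor_sum.
Qed.

End ternary_digits.

Section parametrization.
Set Implicit Arguments.
Unset Strict Implicit.
Context (R : realType).
Local Notation T := (measurableTypeR R).
Local Notation T3 := (T * (T * T))%type.

Definition coordinate (j : nat) (y : T3) : R :=
  match j with 0 => y.1 | 1 => y.2.1 | _ => y.2.2 end.

Lemma measurable_coordinate j : measurable_fun setT (coordinate j).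
Proof.
case: j => [|[|j]]; [exact: measurable_fst| |].
- exact: measurableT_comp measurable_fst measurable_snd.
- exact: measurableT_comp measurable_snd measurable_snd.
Qed.

(** Whether the point lies beyond the k-th rational coordinate hyperplane. *)
Definition cut (k : nat) (y : T3) : bool :=
  if @unpickle (nat * rat)%type k is Some (j, r) then ratr r < coordinate j y else false.

Lemma measurable_cut k : measurable_fun setT (cut k).
Proof.
rewrite /cut; case: unpickle => [[j r]|]; last exact: measurable_cst.
by apply: measurable_fun_ltr; [exact: measurable_cst|exact: measurable_coordinate].
Qed.

(** All the answers to the rational cuts packed in one real number; [decode]
    is a measurable left inverse. *)
Definition encode (y : T3) : T := cantor_sum R (cut ^~ y).

Lemma measurable_encode : measurable_fun setT encode.
Proof. exact: measurable_cantor_sum measurable_cut. Qed.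

(** The lower bound on the j-th coordinate that the k-th bit certifies;
    -oo when there is none. *)
Definition decoded_cut (j k : nat) (s : T) : \bar R :=
  if @unpickle (nat * rat)%type k is Some (i, r) then
    if (i == j) && digit k s then (ratr r)%:E else -oo%E
  else -oo%E.

Lemma measurable_decoded_cut j k : measurable_fun setT (decoded_cut j k).
Proof.
rewrite /decoded_cut; case: unpickle => [[i r]|]; last exact: measurable_cst.
apply: measurable_fun_ifT; [|exact: measurable_cst|exact: measurable_cst].
by apply: measurable_and; [exact: measurable_cst|exact: measurable_digit].
Qed.

Definition decode1 (j : nat) (s : T) : T := fine (esups (decoded_cut j ^~ s) 0).

Lemma measurable_decode1 j : measurable_fun setT (decode1 j).
Proof.
have h : measurable_fun setT (fun s => esups (decoded_cut j ^~ s) 0).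
  by apply: measurable_fun_esups => n; exact: measurable_decoded_cut.
exact: (measurableT_comp (@fine_measurable R setT measurableT) h).
Qed.

Definition decode (s : T) : T3 := (decode1 0 s, (decode1 1 s, decode1 2 s)).

Lemma measurable_decode : measurable_fun setT decode.
Proof.
apply: measurable_fun_pair; first exact: measurable_decode1.
by apply: measurable_fun_pair; exact: measurable_decode1.
Qed.

Lemma decode1_encode j y : decode1 j (encode y) = coordinate j y.
Proof.
rewrite /decode1 (_ : esups _ 0 = (coordinate j y)%:E)//.
apply/eqP; rewrite eq_le; apply/andP; split.
  apply: ub_ereal_sup => _ [k _ <-].
  rewrite /decoded_cut /encode digit_cantor_sum /cut; case: unpickle => [[i r]|]; last exact: leNye.
  case: eqVneq => [->|_] /=; last exact: leNye.
  by case: ltP => [h|_]; [rewrite lee_fin ltW|exact: leNye].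
apply/lee_subgt0Pr => e e0.
have [r] := rat_in_itvoo (ltac:(rewrite ltrBlDr ltrDl; exact: e0) : coordinate j y - e < coordinate j y).
rewrite in_itv/= => /andP[r1 r2].
apply: (@le_trans _ _ (ratr r)%:E); first by rewrite -EFinB lee_fin ltW.
apply: ereal_sup_ubound; exists (pickle (j, r)) => //.
by rewrite /decoded_cut pickleK eqxx/= /encode digit_cantor_sum /cut pickleK r2.
Qed.

Lemma decode_encode y : decode (encode y) = y.
Proof. by rewrite /decode !decode1_encode; case: y => [a [b c]]. Qed.

#[local] HB.instance Definition _ :=
  @isMeasurableFun.Build _ _ T3 T encode measurable_encode.

(** Since [encode] has a measurable left inverse, a law on space is recovered
    from its image on the line, and on the line the quantile function realises
    any law. *)
Definition parametrize (P : probability T3 R) (t : T) : T3 :=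
  decode (quantile (distribution P (encode : {RV P >-> T})) t).

Lemma measurable_parametrize P : measurable_fun setT (parametrize P).
Proof. exact: measurableT_comp measurable_decode (measurable_quantile _). Qed.

Lemma ge0_integral_parametrize (P : probability T3 R) (F : T3 -> \bar R) :
  measurable_fun setT F -> (forall y, 0 <= F y)%E ->
  (\int[lebesgue01 R]_t F (parametrize P t) = \int[P]_y F y)%E.
Proof.
move=> mF F0.
have := @ge0_integral_pushforward _ _ _ _ R _ (measurable_parametrize P) (lebesgue01 R) setT F measurableT mF.
rewrite preimage_setT => <-; last by move=> x _; exact: F0.
apply: eq_measure_integral => [|mp A mA _]; first exact: measurable_parametrize.
pose Q := distribution P (encode : {RV P >-> T}).
change (lebesgue01 R (quantile Q @^-1` (decode @^-1` A)) = P A).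
have mdA : measurable (decode @^-1` A).
  by rewrite -[X in measurable X]setTI; apply: measurable_decode.
rewrite (quantile_law Q mdA) /Q /distribution /pushforward; congr (P _).
by apply/seteqP; split => y /=; rewrite decode_encode.
Qed.

End parametrization.


(** * When the function is a norm *)
Section zonal_norm.
Set Implicit Arguments.
Unset Strict Implicit.
Context (R : realType).
Local Notation T := (measurableTypeR R).
Local Notation T3 := (T * (T * T))%type.

(** The row vector with its third coordinate, the polar one, put first. *)
Definition pt (x : 'rV[R]_3) : T3 := (x 0 2, (x 0 0, x 0 1)).

Definition profile (l u : R) : R := 1 + l - 3 * l * u ^+ 2.

Lemma pt_eq0 x : nrm3 (pt x) = 0 -> x = 0.
Proof.
move/nrm3_eq0 => [h2 h0 h1]; apply/rowP => i; rewrite mxE.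
by case: i => -[|[|[|//]]] hi; [rewrite -[RHS]h0|rewrite -[RHS]h1|rewrite -[RHS]h2];
  congr (x 0 _); apply/val_inj.
Qed.

Lemma nrm3_pt0 : nrm3 (pt 0) = 0.
Proof. by rewrite /nrm3 /sqn3 /pt/= !mxE expr0n/= !addr0 sqrtr0. Qed.

Lemma normNE l x : normN l x = nrm3 (pt x) * profile l (lat3 (pt x)) ^+ 4.
Proof.
rewrite /normN; case: eqVneq => [->|x0]; first by rewrite nrm3_pt0 mul0r.
have s0 : nrm3 (pt x) != 0 by apply: contraNneq x0 => /pt_eq0 ->.
rewrite (_ : Num.sqrt _ = nrm3 (pt x))//; congr (_ * _ ^+ 4).
rewrite (_ : x 0 0 ^+ 2 + x 0 1 ^+ 2 + x 0 2 ^+ 2 = nrm3 (pt x) ^+ 2); last by rewrite sqr_nrm3.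
rewrite (_ : x 0 0 ^+ 2 + _ - _ = nrm3 (pt x) ^+ 2 - 3 * x 0 2 ^+ 2); last first.
  by rewrite sqr_nrm3 /sqn3 /pt/=; ring.
by rewrite /profile /lat3 /pt/=; field.
Qed.

Lemma profile_gt0 (l u : R) : 0 < l -> l <= 1 / 23 -> u ^+ 2 <= 1 -> 0 < profile l u.
Proof. by rewrite /profile => l0 l23 u1; nra. Qed.

(** The left side is the tangent functional at a unit vector of latitude u,
    evaluated at one of latitude v at scalar product c.  With a = p(v) and
    b = p(u), a^4 >= b^3 (4 a - 3 b) removes the fourth power and leaves a
    quadratic inequality, where 1 - 23 l appears at u = 0. *)
Lemma profile_tangent (l u v c : R) : 0 < l -> l <= 1 / 23 -> u ^+ 2 <= 1 -> v ^+ 2 <= 1 ->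
  (v - u) ^+ 2 <= 2 * (1 - c) ->
  c * profile l u ^+ 4 - 24 * l * u * profile l u ^+ 3 * (v - c * u) <= profile l v ^+ 4.
Proof.
move=> l0 l23 u1 v1 vu.
have b0 := profile_gt0 l0 l23 u1.
set b := profile l u in b0 *; set a := profile l v.
have h1 : b ^+ 3 * (4 * a - 3 * b) <= a ^+ 4.
  rewrite -subr_ge0 (_ : _ - _ = (a - b) ^+ 2 * ((a + b) ^+ 2 + 2 * b ^+ 2)); last by ring.
  by apply: mulr_ge0; [exact: sqr_ge0|apply: addr_ge0; last apply: mulr_ge0]; rewrite ?sqr_ge0.
apply: le_trans h1.
rewrite (_ : _ - _ = b ^+ 3 * (c * b - 24 * l * u * (v - c * u))); last by ring.
rewrite ler_pM2l ?exprn_gt0// -subr_ge0.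
rewrite (_ : _ - _ = (1 - c) * (1 + l + 21 * l * u ^+ 2) - 12 * l * (v - u) ^+ 2); last first.
  by rewrite /a /b /profile; ring.
have c1 : 0 <= 1 - c by have := sqr_ge0 (v - u); lra.
have h2 : 12 * l * (v - u) ^+ 2 <= 12 * l * (2 * (1 - c)) by rewrite ler_wpM2l// mulr_ge0// ltW.
have h3 : 0 <= (1 - c) * (1 - 23 * l + 21 * l * u ^+ 2).
  rewrite mulr_ge0// addr_ge0//; first by lra.
  by apply: mulr_ge0; [lra|exact: sqr_ge0].
by lra.
Qed.

(** The polar coordinates of two unit vectors differ by at most their distance. *)
Lemma lat3_dist_le (x y : T3) : nrm3 x != 0 -> nrm3 y != 0 ->
  (lat3 y - lat3 x) ^+ 2 <= 2 * (1 - dot3 x y / (nrm3 x * nrm3 y)).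
Proof.
move=> x0 y0; set s := nrm3 x in x0 *; set r := nrm3 y in y0 *.
have ex : sqn3 x / s ^+ 2 = 1 by rewrite /s sqr_nrm3 divff// -sqr_nrm3 expf_eq0.
have ey : sqn3 y / r ^+ 2 = 1 by rewrite /r sqr_nrm3 divff// -sqr_nrm3 expf_eq0.
have h : (y.1 / r - x.1 / s) ^+ 2 + (y.2.1 / r - x.2.1 / s) ^+ 2 + (y.2.2 / r - x.2.2 / s) ^+ 2 =
   sqn3 y / r ^+ 2 + sqn3 x / s ^+ 2 - 2 * (dot3 x y / (s * r)).
  rewrite /sqn3 /dot3; field; exact/andP.
rewrite ex ey in h; rewrite mulrBr mulr1 (_ : 2 - _ = 1 + 1 - 2 * (dot3 x y / (s * r)))//.
by rewrite -h /lat3 -addrA lerDl addr_ge0 ?sqr_ge0.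
Qed.

(** The derivative at x of |x| p(lat x)^4, in the direction y. *)
Definition support (l : R) (x y : T3) : R :=
  dot3 x y / nrm3 x * profile l (lat3 x) ^+ 4 -
  24 * l * lat3 x * profile l (lat3 x) ^+ 3 * (y.1 - dot3 x y / nrm3 x * lat3 x).

Lemma support_le l (x y : T3) : 0 < l -> l <= 1 / 23 -> nrm3 x != 0 ->
  support l x y <= nrm3 y * profile l (lat3 y) ^+ 4.
Proof.
move=> l0 l23 x0; have [y0|y0] := eqVneq (nrm3 y) 0.
  by rewrite /support y0 mul0r /dot3 (nrm3_eq0 y0)/= !mulr0 !addr0 !mul0r subr0 mulr0 subr0.
have H := profile_tangent l0 l23 (lat3_sqr_le1 x) (lat3_sqr_le1 y) (lat3_dist_le x0 y0).
have r0 : 0 <= nrm3 y := nrm3_ge0 y.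
apply: le_trans (ler_wpM2l r0 H); rewrite le_eqVlt; apply/orP; left; apply/eqP.
have ey : y.1 = nrm3 y * lat3 y by rewrite /lat3 mulrCA divff ?mulr1.
rewrite /support ey; move: (nrm3 x) (nrm3 y) x0 y0 => s r x0 y0.
by field; apply/andP.
Qed.

Lemma support_id l (x : T3) : nrm3 x != 0 ->
  support l x x = nrm3 x * profile l (lat3 x) ^+ 4.
Proof.
move=> x0; rewrite /support.
have ex : x.1 = nrm3 x * lat3 x by rewrite /lat3 mulrCA divff ?mulr1.
have -> : dot3 x x / nrm3 x = nrm3 x.
  have -> : dot3 x x = nrm3 x ^+ 2 by rewrite sqr_nrm3 /dot3 /sqn3; ring.
  by rewrite expr2 mulfK.
by rewrite {1}ex subrr mulr0 subr0.
Qed.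

Lemma supportD l (x : T3) (y z w : T3) :
  w.1 = y.1 + z.1 -> w.2.1 = y.2.1 + z.2.1 -> w.2.2 = y.2.2 + z.2.2 ->
  support l x w = support l x y + support l x z.
Proof. by move=> e1 e2 e3; rewrite /support /dot3 e1 e2 e3; ring. Qed.

Lemma ptZ (a : R) x : nrm3 (pt (a *: x)) = `|a| * nrm3 (pt x).
Proof.
rewrite /nrm3 -sqrtr_sqr -sqrtrM ?sqr_ge0//; congr Num.sqrt.
by rewrite /sqn3 /pt/= !mxE; ring.
Qed.

Lemma normN_is_norm (l : R) : 0 < l -> l <= 1 / 23 -> is_norm (normN l).
Proof.
move=> l0 l23; have p0 x : 0 < profile l (lat3 x) by exact: profile_gt0 (lat3_sqr_le1 x).
have N0 x : 0 <= normN l x.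
  by rewrite normNE mulr_ge0 ?nrm3_ge0// exprn_ge0// ltW.
split=> //.
- move=> x; rewrite normNE => /eqP; rewrite mulf_eq0 expf_eq0/= (gt_eqF (p0 _)) orbF => /eqP.
  exact: pt_eq0.
- move=> a x; rewrite !normNE ptZ -mulrA.
  have [->|a0] := eqVneq a 0; first by rewrite normr0 !mul0r.
  have [x0|x0] := eqVneq (nrm3 (pt x)) 0; first by rewrite x0 !mul0r.
  congr (_ * (_ * _ ^+ 4)); rewrite /profile /lat3 ptZ !expr_div_n exprMn real_normK ?num_real//.
  by rewrite /pt/= !mxE exprMn -mulf_div divff ?mul1r// expf_eq0.
- move=> x y; have [z0|z0] := eqVneq (nrm3 (pt (x + y))) 0.
    by rewrite {1}normNE z0 mul0r addr_ge0.
  rewrite (normNE l (x + y)) -support_id// (@supportD l _ (pt x) (pt y)); try by rewrite /pt/= mxE.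
  by rewrite !normNE lerD// support_le.
Qed.

(** Truncating the binomial expansion after an even power bounds it above. *)
Lemma bonferroni_expr8 (y : R) : 0 <= y -> y <= 1 / 7 -> (1 - y) ^+ 8 <= 1 - 8 * y + 28 * y ^+ 2.
Proof.
move=> y0 y1; rewrite -subr_ge0.
rewrite (_ : _ - _ = y ^+ 3 * (56 - 70 * y) + y ^+ 5 * (56 - 28 * y) + y ^+ 7 * (8 - y)); last by ring.
by rewrite !addr_ge0// mulr_ge0 ?exprn_ge0//; lra.
Qed.

(** The sum of (a, 0, b) and (a, 0, -b), unit vectors with b^2 = t, is
    (2a, 0, 0), so the triangle inequality reads
    a (1 + l)^4 <= (1 + l - 3 l t)^4.  With c = (1 + l) / (3 l), which is
    smaller than 8, and t = c y this is 1 - c y <= (1 - y)^8, false for small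
    positive y. *)
Lemma normN_not_norm (l : R) : 1 / 23 < l -> ~ is_norm (normN l).
Proof.
move=> l23 hN; have l0 : 0 < l by lra.
(* 1 - 8 y + 28 y^2 < 1 - c y as soon as 28 y < 8 - c; y is half of that bound. *)
pose c := (1 + l) / (3 * l); pose y : R := (8 - c) / 56; pose t := c * y.
have cE : 3 * l * c = 1 + l by rewrite /c mulrC divfK// mulf_neq0 ?gt_eqF.
have c0 : 0 < c by rewrite divr_gt0; lra.
have c8 : c < 8 by rewrite ltr_pdivrMr; lra.
have y0 : 0 < y by rewrite /y; lra.
have y7 : y <= 1 / 7 by rewrite /y; lra.
have t0 : 0 < t by rewrite mulr_gt0.
have t1 : t < 1.
  rewrite (_ : t = 2 / 7 - (c - 4) ^+ 2 / 56); last by rewrite /t /y; field.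
  by have := sqr_ge0 (c - 4); lra.
have key : (1 - y) ^+ 8 < 1 - t.
  apply: le_lt_trans (bonferroni_expr8 (ltW y0) y7) _.
  have -> : 1 - 8 * y + 28 * y ^+ 2 = 1 - t - y * ((8 - c) / 2).
    by rewrite (_ : 8 - c = 56 * y) /t /y; [field|field].
  by rewrite ltrBlDr ltrDl mulr_gt0//; lra.
pose a := Num.sqrt (1 - t); pose b := Num.sqrt t.
have a2 : a ^+ 2 = 1 - t by rewrite sqr_sqrtr; lra.
have b2 : b ^+ 2 = t by rewrite sqr_sqrtr; lra.
have a0 : 0 < a by rewrite sqrtr_gt0; lra.
pose vec (p q : R) : 'rV[R]_3 := \row_(i < 3) (nth 0 [:: p; 0; q] i).
have vE p q : pt (vec p q) = (q, (p, 0)) by rewrite /pt /vec !mxE.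
have Nab q : q ^+ 2 = t -> normN l (vec a q) = (1 + l) ^+ 4 * (1 - y) ^+ 4.
  move=> qt; rewrite normNE vE.
  have -> : nrm3 ((q, (a, 0)) : T3) = 1 by rewrite /nrm3 /sqn3/= a2 qt expr0n/= addr0 subrK sqrtr1.
  rewrite mul1r -exprMn /lat3 /nrm3 /sqn3/= a2 qt expr0n/= addr0 subrK sqrtr1 divr1 /profile qt.
  by congr (_ ^+ 4); rewrite mulrBr mulr1 -[X in _ = _ - X * _]cE /t mulrA.
have N2 : normN l (vec (2 * a) 0) = 2 * a * (1 + l) ^+ 4.
  rewrite normNE vE /nrm3 /lat3 /sqn3/= expr0n/= !addr0 mul0r sqrtr_sqr ger0_norm; last by lra.
  by rewrite /profile expr0n/= mulr0 subr0.
have vD : vec a b + vec a (- b) = vec (2 * a) 0.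
  apply/rowP => i; rewrite !mxE.
  by case: i => -[|[|[|//]]] hi /=; rewrite ?addr0 ?subrr// mulr2n mulrDl mul1r.
have := is_normD hN (vec a b) (vec a (- b)).
rewrite vD N2 !Nab ?sqrrN// leNgt => /negP; apply.
have K0 : 0 < (1 + l) ^+ 4 by rewrite exprn_gt0//; lra.
suff h : (1 - y) ^+ 4 < a by have := ltr_pM2l K0 ((1 - y) ^+ 4) a; rewrite h; lra.
rewrite -(@ltr_pXn2r _ 2) ?nnegrE//; last 2 first.
- by rewrite exprn_ge0//; lra.
- exact: ltW.
by rewrite a2 -exprM.
Qed.

End zonal_norm.


(** * Completeness *)
Section banach.
Set Implicit Arguments.
Unset Strict Implicit.
Context (R : realType).

Lemma banach_of_coordinate_bounds n (N : 'rV[R]_n -> R) (hN : is_norm N) (c C : R) :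
  0 < c -> 0 <= C ->
  (forall (x : 'rV[R]_n) i, `|x 0 i| <= c * N x) -> (forall x : 'rV[R]_n, N x <= C * \sum_i `|x 0 i|) ->
  is_banach (normed_by hN).
Proof.
move=> c0 C0 lbN ubN F FF /cauchyP cF.
pose f i (x : normed_by hN) : R := (x : 'rV[R]_n) 0 i.
have cf i : cvg (f i x @[x --> F]).
  apply: cauchy_cvg; apply/cauchyP => e e0.
  have [x Fx] := cF (e / c) (divr_gt0 e0 c0).
  exists (f i x); change (F (f i @^-1` ball (f i x) e)).
  apply: filterS Fx => y; rewrite -!ball_normE /= => xy.
  rewrite (_ : f i x - f i y = ((x : 'rV[R]_n) - y) 0 i); last by rewrite !mxE.
  by apply: le_lt_trans (lbN _ i) _; rewrite mulrC -ltr_pdivlMr.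
pose z : 'rV[R]_n := \row_i lim (f i x @[x --> F]).
apply/cvg_ex; exists (z : normed_by hN); apply/fcvgrPdist_lt => e e0.
pose d := e / (C * n%:R + 1).
have K0 : 0 < C * n%:R + 1 by rewrite ltr_wpDl// mulr_ge0.
have d0 : 0 < d by rewrite divr_gt0.
have : \forall x \near F, forall i, `|z 0 i - f i x| <= d.
  apply: filter_forall => i; rewrite mxE.
  by move: (cf i) => /cvgrPdist_le/(_ d d0).
apply: filterS => x zx.
apply: le_lt_trans (ubN _) _.
apply: (@le_lt_trans _ _ (C * (n%:R * d))).
  rewrite ler_wpM2l//; apply: le_trans (ler_sum _ (G := fun=> d) _) _.
    by move=> i _; rewrite !mxE; move: (zx i); rewrite !mxE.
  by rewrite sumr_const card_ord mulr_natl.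
have -> : e = d * (C * n%:R + 1) by rewrite /d divfK// gt_eqF.
by move: d0; clear; move: d => d; lra.
Qed.

Lemma normN_banach (l : R) (hN : is_norm (normN l)) :
  0 < l -> l <= 1 / 23 -> is_banach (normed_by hN).
Proof.
move=> l0 l23; have k0 : 0 < 1 - 2 * l by lra.
have coord (x : 'rV[R]_3) i : `|x 0 i| <= nrm3 (pt x).
  rewrite -sqrtr_sqr ler_wsqrtr// /sqn3 /pt/=.
  have h0 := sqr_ge0 (x 0 0); have h1 := sqr_ge0 (x 0 1); have h2 := sqr_ge0 (x 0 2).
  case: i => -[|[|[|//]]] hi.
  - by rewrite (_ : x 0 (Ordinal hi) = x 0 0); [lra|congr (x 0 _); apply/val_inj].
  - by rewrite (_ : x 0 (Ordinal hi) = x 0 1); [lra|congr (x 0 _); apply/val_inj].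
  - by rewrite (_ : x 0 (Ordinal hi) = x 0 2); [lra|congr (x 0 _); apply/val_inj].
apply: (@banach_of_coordinate_bounds 3 (normN l) hN ((1 - 2 * l) ^- 4) ((1 + l) ^+ 4)).
- by rewrite invr_gt0 exprn_gt0.
- by rewrite exprn_ge0//; lra.
- move=> x i; rewrite ler_pdivlMl ?exprn_gt0// normNE mulrC.
  apply: ler_pM => //.
  + by rewrite exprn_ge0// ltW.
  + apply: lerXn2r; rewrite ?nnegrE.
    * exact: ltW.
    * by apply/ltW/profile_gt0 => //; exact: lat3_sqr_le1.
    * by rewrite /profile; have := lat3_sqr_le1 (pt x); nra.
- move=> x; rewrite normNE mulrC; apply: ler_pM.
  + by rewrite exprn_ge0//; apply/ltW/profile_gt0 => //; exact: lat3_sqr_le1.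
  + exact: nrm3_ge0.
  + apply: lerXn2r; rewrite ?nnegrE.
    * by apply/ltW/profile_gt0 => //; exact: lat3_sqr_le1.
    * by lra.
    * by rewrite /profile; have := sqr_ge0 (lat3 (pt x)); nra.
  + rewrite -[leRHS]ger0_norm ?sumr_ge0// -sqrtr_sqr ler_wsqrtr//.
    rewrite !big_ord_recr big_ord0/= add0r /sqn3 /pt/=.
    rewrite (_ : widen_ord _ _ = 0 :> 'I_3); last exact/val_inj.
    rewrite (_ : widen_ord _ _ = 1 :> 'I_3); last exact/val_inj.
    rewrite (_ : ord_max = 2 :> 'I_3); last exact/val_inj.
    rewrite -(real_normK (num_real (x 0 0))) -(real_normK (num_real (x 0 1))) -(real_normK (num_real (x 0 2))).
    have := normr_ge0 (x 0 0); have := normr_ge0 (x 0 1); have := normr_ge0 (x 0 2).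
    move: `|x 0 0| `|x 0 1| `|x 0 2| => a b c c0 b0 a0.
    rewrite -subr_ge0 (_ : _ - _ = 2 * (a * b + a * c + b * c)); last by ring.
    by rewrite mulr_ge0// !addr_ge0// mulr_ge0.
Qed.

End banach.


(** * Explicit densities for the exponents 1/4 and 1/2 *)
Section representation.
Set Implicit Arguments.
Unset Strict Implicit.
Context (R : realType).
Local Notation T := (measurableTypeR R).
Local Notation T3 := (T * (T * T))%type.

Lemma LnormP d (S : measurableType d) (mu : {measure set S -> \bar R}) (q v : R) (f : S -> R) :
  0 < q -> 0 <= v ->
  ('N[mu]_q%:E[EFin \o f] = v%:E)%E <-> (\int[mu]_t (`|f t| `^ q)%:E = (v `^ q)%:E)%E.
Proof.
move=> q0 v0; have qn : q != 0 by rewrite gt_eqF.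
have eI : (\int[mu]_t (`|f t| `^ q)%:E = \int[mu]_t `|(EFin \o f) t| `^ q)%E.
  by apply: eq_integral => t _; rewrite -poweR_EFin.
split => [h|h]; first by rewrite eI -(powR_Lnorm mu (EFin \o f) qn) h poweR_EFin.
by rewrite unlock /Lnorm -eI h poweR_EFin -powRrM divff// powRr1.
Qed.

(** With C = 0, matching [mean_is_dens4] at q = 1/4 with 1 + l - 3 l u^2 gives
    B from the coefficient of u^2, then A from the constant term. *)
Definition density_quarter (l : R) (y : T3) : R :=
  dens4 (16 * (1 + 13 * l) / 273 / mom (1 / 4 : R)) (- (16 * l / 7) / mom (1 / 4 : R)) 0 y.

Lemma mean_is_quarter (l : R) (x : T3) : 0 < l -> l <= 1 / 23 ->
  mean_is (gauss3 R) (fun y => `|dot3 x y| `^ (1 / 4) * density_quarter l y)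
    ((nrm3 x * profile l (lat3 x) ^+ 4) `^ (1 / 4)).
Proof.
move=> l0 l23; have m0 : 0 < mom (1 / 4 : R) by apply: mom_gt0; lra.
have q0 : (0 : R) < 1 / 4 by lra.
have := mean_is_dens4 (16 * (1 + 13 * l) / 273 / mom (1 / 4 : R)) (- (16 * l / 7) / mom (1 / 4 : R)) 0 x q0.
set v := (X in mean_is _ _ X); set w := (X in _ -> mean_is _ _ X).
have -> : v = w.
  have p0 : 0 <= profile l (lat3 x) by apply/ltW/profile_gt0 => //; exact: lat3_sqr_le1.
  rewrite /w powRM ?nrm3_ge0 ?exprn_ge0// -powR_mulrn// -powRrM.
  rewrite (_ : 4 * (1 / 4) = 1); last by field.
  rewrite powRr1// /v /profile; move: (nrm3 x `^ _) (lat3 x) (mom _) m0 => a u m m0.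
  by field; rewrite gt_eqF.
by apply: mean_is_ext => y; rewrite dot3C.
Qed.

(** A and A + B are nonnegative, being the values at the equator and at the
    pole, and the density interpolates between them. *)
Lemma density_quarter_ge0 (l : R) (y : T3) : 0 < l -> l <= 1 / 26 -> 0 <= density_quarter l y.
Proof.
move=> l0 l26; have m0 : 0 < mom (1 / 4 : R) by apply: mom_gt0; lra.
rewrite /density_quarter /dens4 mul0r addr0.
have -> : 16 * (1 + 13 * l) / 273 / mom (1 / 4 : R) * sqn3 y ^+ 2 + - (16 * l / 7) / mom (1 / 4 : R) * (sqn3 y * y.1 ^+ 2) =
   (mom (1 / 4 : R))^-1 * sqn3 y * (16 * (1 + 13 * l) / 273 * (sqn3 y - y.1 ^+ 2) + 16 * (1 - 26 * l) / 273 * y.1 ^+ 2).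
  by field; rewrite gt_eqF.
have h1 : 0 <= sqn3 y - y.1 ^+ 2 by rewrite /sqn3 addrK addr_ge0// sqr_ge0.
have h2 := sqn3_ge0 y; have h3 := sqr_ge0 y.1.
have h4 : 0 <= (mom (1 / 4 : R))^-1 by rewrite invr_ge0 ltW.
apply: mulr_ge0; first exact: mulr_ge0.
by apply: addr_ge0; apply: mulr_ge0 => //; lra.
Qed.

(** Matching [mean_is_dens4] at q = 1/2 with (1 + l - 3 l u^2)^2 gives C from
    the coefficient of u^4, then B and A. *)
Definition half_A (l : R) : R := 4 / 77 * (1 + 14 * l - 23 * l ^+ 2) / mom (1 / 2 : R).
Definition half_B (l : R) : R := 4 / 11 * (30 * l ^+ 2 - 6 * l) / mom (1 / 2 : R).
Definition half_C (l : R) : R := - (12 * l ^+ 2) / mom (1 / 2 : R).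

Lemma mean_is_half (l : R) (x : T3) : 0 < l -> l <= 1 / 23 ->
  mean_is (gauss3 R) (fun y => `|dot3 x y| `^ (1 / 2) * dens4 (half_A l) (half_B l) (half_C l) y)
    ((nrm3 x * profile l (lat3 x) ^+ 4) `^ (1 / 2)).
Proof.
move=> l0 l23; have m0 : 0 < mom (1 / 2 : R) by apply: mom_gt0; lra.
have q0 : (0 : R) < 1 / 2 by lra.
have := mean_is_dens4 (half_A l) (half_B l) (half_C l) x q0.
set v := (X in mean_is _ _ X); set w := (X in _ -> mean_is _ _ X).
have -> : v = w.
  have p0 : 0 <= profile l (lat3 x) by apply/ltW/profile_gt0 => //; exact: lat3_sqr_le1.
  rewrite /w powRM ?nrm3_ge0 ?exprn_ge0// -powR_mulrn// -powRrM.
  rewrite (_ : 4 * (1 / 2) = 2%:R); last by field.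
  rewrite powR_mulrn// /v /profile /half_A /half_B /half_C.
  move: (nrm3 x `^ _) (lat3 x) (mom _) m0 => a u m m0.
  by field; rewrite gt_eqF.
by apply: mean_is_ext => y; rewrite dot3C.
Qed.

End representation.


(** * Embeddings and obstructions *)
Section embeddings.
Set Implicit Arguments.
Unset Strict Implicit.
Context (R : realType).
Local Notation T := (measurableTypeR R).
Local Notation T3 := (T * (T * T))%type.

Lemma mem_Lfun (q v : R) (f : T -> R) : measurable_fun setT f ->
  ('N[lebesgue01 R]_q%:E[EFin \o f] = v%:E)%E -> f \in Lfun (lebesgue01 R) q%:E.
Proof.
move=> mf fv; apply/andP; split; rewrite inE//=.
by rewrite /finite_norm fv ltry.
Qed.

Lemma measurable_dot3r (x : T3) : measurable_fun setT (dot3 x).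
Proof.
rewrite (_ : dot3 x = (fun y => dot3 y x)); last by apply/funext => y; rewrite dot3C.
exact: measurable_dot3.
Qed.

(** The fourth power of the density compensates the exponent 1/4. *)
Lemma embedding_quarter (l : R) (hN : is_norm (normN l)) : 0 < l -> l <= 1 / 26 ->
  isometric_to_subspace_Lq (1 / 4) (normed_by hN).
Proof.
move=> l0 l26; have l23 : l <= 1 / 23 by lra.
pose Y := parametrize (gauss3 R).
have mY : measurable_fun setT Y by exact: measurable_parametrize.
pose S (x : normed_by hN) (t : T) : R := density_quarter l (Y t) ^+ 4 * dot3 (pt x) (Y t).
have mF x : measurable_fun setT (fun y : T3 => density_quarter l y ^+ 4 * dot3 x y).
  apply: measurable_funM; first by apply: measurable_funX; exact: measurable_dens4.
  exact: measurable_dot3r.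
have mS x : measurable_fun setT (S x) by exact: measurableT_comp (mF (pt x)) mY.
have nS x : ('N[lebesgue01 R]_(1 / 4)%:E[EFin \o S x] = (normN l x)%:E)%E.
  apply/LnormP; [by lra|exact: (is_norm_ge0 hN)|].
  have mG : measurable_fun setT (fun y : T3 => (`|density_quarter l y ^+ 4 * dot3 (pt x) y| `^ (1 / 4))%:E).
    apply/measurable_EFinP.
    exact: (measurableT_comp (@measurable_abs_powR R (1 / 4)) (mF (pt x))).
  have G0 (y : T3) : (0 <= (`|density_quarter l y ^+ 4 * dot3 (pt x) y| `^ (1 / 4))%:E)%E.
    by rewrite lee_fin powR_ge0.
  have := ge0_integral_parametrize (gauss3 R) mG G0.
  move=> h; apply: etrans; first exact: h.
  rewrite normNE -(mean_is_integral (mean_is_quarter (pt x) l0 l23)).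
  apply: eq_integral => y _; congr EFin.
  have d0 := density_quarter_ge0 y l0 l26.
  rewrite normrM powRM// normrX (ger0_norm d0) -powR_mulrn// -powRrM.
  by rewrite (_ : 4 * (1 / 4) = 1) ?powRr1 1?mulrC//; field.
exists S; split.
- by move=> x; exact: mem_Lfun (nS x).
- move=> a x y; apply: aeW => t _; rewrite /S mulrCA -mulrDr; congr (_ * _).
  by rewrite /dot3 /pt/= !mxE; ring.
- exact: nS.
Qed.

Lemma wmoment_hermite_even_neq0 (q : R) k : 0 < q < 2 -> wmoment q (hermite R k.*2) != 0.
Proof.
move=> /andP[q0 q2]; rewrite wmoment_hermite_even ?ltW// mulf_neq0//; last first.
  by rewrite gt_eqF// mom_gt0// ltW//= ltW.
apply/prodf_neq0 => i _; case: i => -[|i] hi /=; first by rewrite subr0 gt_eqF.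
rewrite lt_eqF// subr_lt0; apply: lt_le_trans q2 _.
by rewrite doubleS (ler_nat R 2).
Qed.

(** The images f_i of the basis vectors determine the embedding up to null
    sets, and then [zonal_duality] applies to f = (f_3, (f_1, f_2)). *)
Lemma pole_ge0_of_embedding (l : R) (hN : is_norm (normN l)) (q A B C : R) :
  0 < q < 2 ->
  (forall x : T3, mean_is (gauss3 R) (fun y => `|dot3 x y| `^ q * dens4 A B C y)
    ((nrm3 x * profile l (lat3 x) ^+ 4) `^ q)) ->
  isometric_to_subspace_Lq q (normed_by hN) -> 0 <= A + B + C.
Proof.
move=> q02 HV [S [SL Slin Snorm]].
have q0 : 0 < q by case/andP: q02.
have q02' : 0 < q <= 2 by case/andP: q02 => -> /ltW ->.
have q02'' : 0 <= q <= 2 by case/andP: q02 => /ltW -> /ltW ->.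
have mS x : measurable_fun setT (S x).
  by have := sub_Lfun_mfun (SL x); rewrite inE.
pose e (i : 'I_3) : normed_by hN := (delta_mx 0 i : 'rV[R]_3).
pose f (t : T) : T3 := (S (e 2) t, (S (e 0) t, S (e 1) t)).
have mf : measurable_fun setT f.
  apply: (measurable_fun_pair (mS (e 2))).
  exact: (measurable_fun_pair (mS (e 0)) (mS (e 1))).
have Sdot (x : normed_by hN) : S x = (fun t => dot3 (pt x) (f t)) %[ae lebesgue01 R].
  have a0 := Slin 1 0 0.
  have a2 := Slin ((x : 'rV[R]_3) 0 2) (e 2) 0.
  have a1 := Slin ((x : 'rV[R]_3) 0 1) (e 1) ((x : 'rV[R]_3) 0 2 *: e 2 + 0).
  have a3 := Slin ((x : 'rV[R]_3) 0 0) (e 0) ((x : 'rV[R]_3) 0 1 *: e 1 + ((x : 'rV[R]_3) 0 2 *: e 2 + 0)).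
  have ex : (x : 'rV[R]_3) 0 0 *: e 0 + ((x : 'rV[R]_3) 0 1 *: e 1 + ((x : 'rV[R]_3) 0 2 *: e 2 + 0)) = x.
    apply/rowP => i; rewrite !mxE.
    case: i => -[|[|[|//]]] hi /=; rewrite ?mulr0 ?mulr1 ?addr0 ?add0r;
      by congr ((x : 'rV[R]_3) 0 _); apply/val_inj.
  rewrite ex in a3; rewrite scaler0 addr0 in a0.
  apply: filterS3 (filterI a0 a1) a2 a3 => t [b0 b1] b2 b3 _.
  have {}b0 := b0 I; have {}b1 := b1 I; have {}b2 := b2 I; have {}b3 := b3 I.
  have z0 : S 0 t = 0 by move: b0; lra.
  by rewrite b3 b1 b2 z0 /dot3 /pt/=; ring.
have fV (x : T3) : mean_is (lebesgue01 R) (fun t => `|dot3 x (f t)| `^ q)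
    ((nrm3 x * profile l (lat3 x) ^+ 4) `^ q).
  pose v : normed_by hN := \row_(i < 3) (nth 0 [:: x.2.1; x.2.2; x.1] i).
  have vx : pt v = x by rewrite /pt /v !mxE/=; case: (x) => [? []].
  have md : measurable_fun setT (fun t => `|dot3 x (f t)| `^ q).
    apply: (measurableT_comp (@measurable_abs_powR R q)).
    exact: measurableT_comp (measurable_dot3r x) mf.
  apply: ge0_mean_is => //.
  rewrite -{2 3}vx -normNE.
  have /LnormP := Snorm v; move=> /(_ q0 (is_norm_ge0 hN v)) <-.
  apply: ae_eq_integral => //.
  - exact/measurable_EFinP.
  - by apply/measurable_EFinP; exact: (measurableT_comp (@measurable_abs_powR R q) (mS v)).
  - by apply: filterS (Sdot v) => t h _; rewrite (h I) vx.
have fin01 : fin_num_fun (lebesgue01 R).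
  move=> D mD; rewrite ge0_fin_numE//; apply: (@le_lt_trans _ _ (lebesgue_measure (`[0, 1]%classic : set T))).
    by apply: le_measure; rewrite ?inE; [apply: measurableI => //; exact: measurable_itv|exact: measurable_itv|exact: subIsetr].
  by rewrite lebesgue_measure_itv/= lte_fin ltr01 -EFinD ltry.
pose m : {finite_measure set T -> \bar R} := HB.pack (lebesgue01 R : set T -> \bar R)
  (Measure.class (lebesgue01 R)) (Measure_isFinite.Build _ T R (lebesgue01 R) fin01).
apply: (@pole_ge0 R q A B C q02'') => k.
exact: (@zonal_duality R _ T m f q A B C _ k q02' mf fV HV (wmoment_hermite_even_neq0 k q02)).
Qed.

End embeddings.


Lemma le26_of_embedding_quarter (R : realType) (l : R) (hN : is_norm (normN l)) :
  0 < l -> l <= 1 / 23 -> isometric_to_subspace_Lq (1 / 4) (normed_by hN) -> l <= 1 / 26.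
Proof.
move=> l0 l23 hT.
have q02 : 0 < (1 / 4 : R) < 2 by apply/andP; split; lra.
have m0 : 0 < mom (1 / 4 : R) by apply: mom_gt0; lra.
have := pole_ge0_of_embedding q02 (fun x => mean_is_quarter x l0 l23) hT.
rewrite addr0 -mulrDl pmulr_lge0 ?invr_gt0// => h.
by lra.
Qed.

Lemma not_embedding_half (R : realType) (l : R) (hN : is_norm (normN l)) :
  l <= 1 / 23 -> 1 / 28 < l -> ~ isometric_to_subspace_Lq (1 / 2) (normed_by hN).
Proof.
move=> l23 l28 hT; have l0 : 0 < l by lra.
have q02 : 0 < (1 / 2 : R) < 2 by apply/andP; split; lra.
have m0 : 0 < mom (1 / 2 : R) by apply: mom_gt0; lra.
have := pole_ge0_of_embedding q02 (fun x => mean_is_half x l0 l23) hT.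
rewrite /half_A /half_B /half_C -!mulrDl pmulr_lge0 ?invr_gt0// => h.
by have := sqr_ge0 l; lra.
Qed.


Theorem theorem2 (R : realType) (lambda : R) (lambda_gt0 : 0 < lambda) :
  [/\ is_norm (normN lambda) <-> lambda <= 1 / 23,
      lambda <= 1 / 23 ->
        exists hN : is_norm (normN lambda),
          [/\ is_banach (normed_by hN),
              isometric_to_subspace_Lq (1 / 4) (normed_by hN) <->
                lambda <= 1 / 26 &
              1 / 28 < lambda ->
                ~ isometric_to_subspace_Lq (1 / 2) (normed_by hN)] &
      1 / 28 < lambda -> lambda <= 1 / 26 ->
        exists hN : is_norm (normN lambda),
          [/\ is_banach (normed_by hN),
              isometric_to_subspace_Lq (1 / 4) (normed_by hN) &
              ~ isometric_to_subspace_Lq (1 / 2) (normed_by hN)]].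
Proof.
have norm_iff : is_norm (normN lambda) <-> lambda <= 1 / 23.
  split; last exact: normN_is_norm.
  by move=> hN; rewrite leNgt; apply/negP => /normN_not_norm; exact.
split=> // [l23|l28 l26].
  have hN := normN_is_norm lambda_gt0 l23.
  exists hN; split.
  - exact: normN_banach.
  - by split; [exact: le26_of_embedding_quarter|exact: embedding_quarter].
  - exact: not_embedding_half.
have l23 : lambda <= 1 / 23 by lra.
have hN := normN_is_norm lambda_gt0 l23.
exists hN; split.
- exact: normN_banach.
- exact: embedding_quarter.
- exact: not_embedding_half.
Qed.
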